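(* Let $\alpha\neq0$ and $\lambda\in\mathbb{R}$. Along every solution $g_t$, $t\in I$, of the evolution equation $g''=\Gamma^-_g(g',g')-2\alpha\operatorname{grad}^-S_\lambda(g)$ satisfying the momentum constraint $\delta^{-}_{g_t}g'_t=0$ (for instance, any solution satisfying it at one instant), the density $$\mathcal{H}_\lambda(g_t,g'_t)\,\mu_{g_t}$$ does not depend on $t$, pointwise on $M$. Equivalently, $$\mathcal{H}_\lambda(g_t,g'_t)(p)=\mathcal{H}_\lambda(g_{t_0},g'_{t_0})(p)\,\exp\Bigl(-\tfrac12\int_{t_0}^{t}\operatorname{tr}_{g_s}(g'_s)(p)\,ds\Bigr)$$ for every $p\in M$ (and $t,t_0\in I$).
   Context: $M$ is a compact connected smooth manifold without boundary, $\dim M=n\ge2$. $S^2(M)$ is the Fréchet space of smooth symmetric $(0,2)$-tensor fields on $M$, and $\mathcal{M}\subset S^2(M)$ is the open cone of Riemannian metrics. A solution $g_t$, $t\in I$ ($I$ an open interval), is a smooth curve in $\mathcal{M}$; primes denote $t$-derivatives. For $g\in\mathcal{M}$: $\rho(g)$ is the Ricci tensor, $\tau(g)=\operatorname{tr}_g\rho(g)$ the scalar curvature, $\mu_g$ the volume density, $\operatorname{tr}_gh=\operatorname{tr}(g^{-1}h)$, $(\delta_gh)_j=-g^{ik}\nabla_ih_{kj}$, and $$\langle h,k\rangle^-_g=\operatorname{tr}(g^{-1}hg^{-1}k)-\operatorname{tr}_g(h)\operatorname{tr}_g(k),\qquad G^-_g(h,k)=\int_M\langle h,k\rangle^-_g\,\mu_g,\qquad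 \delta^-_gh=\delta_gh+d(\operatorname{tr}_gh).$$ $\Gamma^-_g(h,h)=hg^{-1}h-\tfrac12\operatorname{tr}_g(h)h-\tfrac{1}{4(n-1)}\langle h,h\rangle^-_g\,g$ is the Christoffel map of $G^-$. Further, $\tau_\lambda(g)=\tau(g)-\lambda(n-1)$, $S_\lambda(g)=\int_M\tau_\lambda(g)\mu_g$, with $G^-$-gradient $\operatorname{grad}^-S_\lambda(g)=-\rho(g)+\frac{1}{2(n-1)}\tau(g)g+\frac{\lambda}{2}g$, and $\mathcal{H}_\lambda(g,k)=\tfrac12\langle k,k\rangle^-_g+2\alpha\tau_\lambda(g)\in C^\infty(M)$. *)

(* Defs.v *)
From HB Require Import structures.
From mathcomp Require Import all_boot all_order all_algebra.
From mathcomp Require Import all_classical all_reals all_analysis.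
Set Implicit Arguments.
Unset Strict Implicit.
Unset Printing Implicit Defensive.
Import Order.TTheory GRing.Theory Num.Theory.
Import numFieldNormedType.Exports.
Local Open Scope classical_set_scope.
Local Open Scope ring_scope.

Definition pd (R : realType) (n : nat) (i : 'I_n) (f : 'rV[R]_n -> R) :
    'rV[R]_n -> R :=
  fun x => 'D_(delta_mx 0 i) f x.

(* The multi-index is the list of the directions of differentiation. *)
Definition pds (R : realType) (n : nat) (s : seq 'I_n) (f : 'rV[R]_n -> R) :
    'rV[R]_n -> R :=
  foldr (@pd R n) f s.

(* Intended for U open. *)
Definition smooth_on (R : realType) (n : nat) (U : set 'rV[R]_n)
    (f : 'rV[R]_n -> R) : Prop :=
  forall (s : seq 'I_n) (x : 'rV[R]_n), U x ->
    {for x, continuous (pds s f)} /\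
    forall i : 'I_n, derivable (pds s f) x (delta_mx 0 i).

(* [cfun] only matters on [cdom] and [cinv] only on [cfun @` cdom]. *)
Record chart (R : realType) (n : nat) (M : topologicalType) := Chart {
  cdom : set M;
  cfun : M -> 'rV[R]_n;
  cinv : 'rV[R]_n -> M;
  cdom_open : open cdom;
  cimg_open : open (cfun @` cdom);
  cfunK : forall p, cdom p -> cinv (cfun p) = p;
  cfun_cont : {within cdom, continuous cfun};
  cinv_cont : {within cfun @` cdom, continuous cinv} }.

Definition cimg (R : realType) (n : nat) (M : topologicalType)
    (a : chart R n M) : set 'rV[R]_n :=
  cfun a @` cdom a.

(* The j-th coordinate of chart [b] as a function of the coordinates of
   chart [a]. *)
Definition transition (R : realType) (n : nat) (M : topologicalType)
    (a b : chart R n M) (j : 'I_n) : 'rV[R]_n -> R :=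
  fun x => cfun b (cinv a x) 0 j.

(* A smooth structure of dimension n on M is given by a smooth atlas, not
   necessarily maximal, written as an indexed family of charts. *)
Record smooth_atlas (R : realType) (n : nat) (M : topologicalType) := Atlas {
  aidx :> Type;
  achart : aidx -> chart R n M;
  acover : forall p, exists a, cdom (achart a) p;
  acompat : forall a b j,
    smooth_on (cfun (achart a) @` (cdom (achart a) `&` cdom (achart b)))
      (transition (achart a) (achart b) j) }.

(* Entry (i, j) is d y^j / d x^i, where x are the coordinates of [a] and y
   those of [b]. *)
Definition jacobian (R : realType) (n : nat) (M : topologicalType)
    (a b : chart R n M) (p : M) : 'M[R]_n :=
  \matrix_(i, j) pd i (transition a b j) (cfun a p).

Definition cpd (R : realType) (n : nat) (M : topologicalType)
    (a : chart R n M) (i : 'I_n) (f : M -> R) : M -> R :=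
  fun p => pd i (f \o cinv a) (cfun a p).

(* A (0,2)-tensor field is given by its components: [h a p] is the matrix
   (h_ij(p)) in the chart of index [a], and only matters for p in the domain
   of that chart.  Scalars built from tensors below are likewise written in a
   chart; they do not depend on it when the components transform
   tensorially. *)
Definition components (R : realType) (n : nat) (M : topologicalType)
    (A : smooth_atlas R n M) : Type :=
  A -> M -> 'M[R]_n.

Definition coord (R : realType) (n : nat) (M : topologicalType)
    (A : smooth_atlas R n M) (h : components A) (a : A) (i j : 'I_n) :
    'rV[R]_n -> R :=
  fun x => h a (cinv (achart a) x) i j.

Definition in_S2 (R : realType) (n : nat) (M : topologicalType)
    (A : smooth_atlas R n M) (h : components A) : Prop :=
  [/\ forall a p, cdom (achart a) p -> (h a p)^T = h a p,
      forall a b p, cdom (achart a) p -> cdom (achart b) p ->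
        h a p = jacobian (achart a) (achart b) p *m h b p
                  *m (jacobian (achart a) (achart b) p)^T
    & forall a i j, smooth_on (cimg (achart a)) (coord h a i j)].

Definition in_Met (R : realType) (n : nat) (M : topologicalType)
    (A : smooth_atlas R n M) (g : components A) : Prop :=
  in_S2 g /\
  forall a p (v : 'rV[R]_n), cdom (achart a) p -> v != 0 ->
    0 < (v *m g a p *m v^T) 0 0.

(* Convergence in the Frechet space S^2(M): uniform convergence of all
   coordinate derivatives of the components on the compact subsets of every
   chart. *)
Definition S2_cvg (R : realType) (n : nat) (M : topologicalType)
    (A : smooth_atlas R n M) (F : set_system R) (h : R -> components A)
    (l : components A) : Prop :=
  forall (a : A) (K : set 'rV[R]_n), compact K -> K `<=` cimg (achart a) ->
  forall (s : seq 'I_n) (i j : 'I_n) (e : R), 0 < e ->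
    \forall u \near F, forall x, K x ->
      `|pds s (coord (h u) a i j) x - pds s (coord l a i j) x| < e.

Definition S2_derivative (R : realType) (n : nat) (M : topologicalType)
    (A : smooth_atlas R n M) (c : R -> components A) (t : R)
    (l : components A) : Prop :=
  S2_cvg (0 : R)^' (fun u a p => u^-1 *: (c (t + u) a p - c t a p)) l.

(* The derivative g' of a curve, computed componentwise; for a differentiable
   curve in S^2(M) it is the derivative in the Frechet space. *)
Definition tderiv (R : realType) (n : nat) (M : topologicalType)
    (A : smooth_atlas R n M) (c : R -> components A) : R -> components A :=
  fun t a p => \matrix_(i, j) derive1 (fun s : R => c s a p i j) t.

(* Infinitely differentiable curves I -> S^2(M), I open; values outside I do
   not matter. *)
Definition smooth_curve (R : realType) (n : nat) (M : topologicalType)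
    (A : smooth_atlas R n M) (I : set R) (c : R -> components A) : Prop :=
  forall (k : nat) (t : R), I t ->
    in_S2 (iter k (@tderiv R n M A) c t) /\
    S2_derivative (iter k (@tderiv R n M A) c) t
      (iter k.+1 (@tderiv R n M A) c t).

Definition trg (R : realType) (n : nat) (g h : 'M[R]_n) : R :=
  \tr (invmx g *m h).

(* <h, k>^-_g *)
Definition ipm (R : realType) (n : nat) (g h k : 'M[R]_n) : R :=
  \tr (invmx g *m h *m invmx g *m k) - trg g h * trg g k.

(* Gamma^-_g(h, h) *)
Definition Gammam (R : realType) (n : nat) (g h : 'M[R]_n) : 'M[R]_n :=
  h *m invmx g *m h - (2^-1 * trg g h) *: h
    - ((4 * (n%:R - 1))^-1 * ipm g h h) *: g.

(* Gamma^k_ij *)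
Definition christoffel (R : realType) (n : nat) (M : topologicalType)
    (A : smooth_atlas R n M) (g : components A) (a : A) (k i j : 'I_n)
    (p : M) : R :=
  2^-1 * \sum_(l < n) invmx (g a p) k l *
    (cpd (achart a) i (fun q => g a q j l) p
     + cpd (achart a) j (fun q => g a q i l) p
     - cpd (achart a) l (fun q => g a q i j) p).

(* (nabla_i h)_kj *)
Definition nabla (R : realType) (n : nat) (M : topologicalType)
    (A : smooth_atlas R n M) (g h : components A) (a : A) (i k j : 'I_n)
    (p : M) : R :=
  cpd (achart a) i (fun q => h a q k j) p
  - \sum_(l < n) christoffel g a l i k p * h a p l j
  - \sum_(l < n) christoffel g a l i j p * h a p k l.

(* The coefficient of d_l in R(d_i, d_j) d_k, where
   R(X, Y) = [nabla_X, nabla_Y] - nabla_[X, Y]. *)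
Definition riemann (R : realType) (n : nat) (M : topologicalType)
    (A : smooth_atlas R n M) (g : components A) (a : A) (l k i j : 'I_n)
    (p : M) : R :=
  cpd (achart a) i (christoffel g a l j k) p
  - cpd (achart a) j (christoffel g a l i k) p
  + \sum_(m < n) (christoffel g a l i m p * christoffel g a m j k p
                  - christoffel g a l j m p * christoffel g a m i k p).

(* rho(g); with this sign the round spheres have positive Ricci tensor. *)
Definition ricci (R : realType) (n : nat) (M : topologicalType)
    (A : smooth_atlas R n M) (g : components A) : components A :=
  fun a p => \matrix_(j, k) \sum_(i < n) riemann g a i k i j p.

Definition scal (R : realType) (n : nat) (M : topologicalType)
    (A : smooth_atlas R n M) (g : components A) (a : A) (p : M) : R :=
  trg (g a p) (ricci g a p).

Definition scal_lambda (R : realType) (n : nat) (M : topologicalType)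
    (A : smooth_atlas R n M) (lambda : R) (g : components A) (a : A)
    (p : M) : R :=
  scal g a p - lambda * (n%:R - 1).

(* The component sqrt(det g_ij) of the volume density mu_g. *)
Definition mu (R : realType) (n : nat) (M : topologicalType)
    (A : smooth_atlas R n M) (g : components A) (a : A) (p : M) : R :=
  Num.sqrt (\det (g a p)).

(* (delta_g h)_j *)
Definition delta (R : realType) (n : nat) (M : topologicalType)
    (A : smooth_atlas R n M) (g h : components A) (a : A) (j : 'I_n)
    (p : M) : R :=
  - \sum_(i < n) \sum_(k < n) invmx (g a p) i k * nabla g h a i k j p.

(* (delta^-_g h)_j *)
Definition deltam (R : realType) (n : nat) (M : topologicalType)
    (A : smooth_atlas R n M) (g h : components A) (a : A) (j : 'I_n)
    (p : M) : R :=
  delta g h a j p + cpd (achart a) j (fun q => trg (g a q) (h a q)) p.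

Definition gradS (R : realType) (n : nat) (M : topologicalType)
    (A : smooth_atlas R n M) (lambda : R) (g : components A) :
    components A :=
  fun a p => - ricci g a p + ((2 * (n%:R - 1))^-1 * scal g a p) *: g a p
             + (lambda / 2) *: g a p.

Definition Hlambda (R : realType) (n : nat) (M : topologicalType)
    (A : smooth_atlas R n M) (alpha lambda : R) (g k : components A) (a : A)
    (p : M) : R :=
  2^-1 * ipm (g a p) (k a p) (k a p)
    + 2 * alpha * scal_lambda lambda g a p.

Definition solution (R : realType) (n : nat) (M : topologicalType)
    (A : smooth_atlas R n M) (alpha lambda : R) (I : set R)
    (g : R -> components A) : Prop :=
  [/\ smooth_curve I g,
      forall t, I t -> in_Met (g t)
    & forall t, I t -> forall a p, cdom (achart a) p ->
        tderiv (tderiv g) t a p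
        = Gammam (g t a p) (tderiv g t a p)
          - (2 * alpha) *: gradS lambda (g t) a p].

Definition momentum_constraint (R : realType) (n : nat) (M : topologicalType)
    (A : smooth_atlas R n M) (g k : components A) : Prop :=
  forall a p, cdom (achart a) p -> forall j, deltam g k a j p = 0.

(* The integral of f from t0 to t, with the usual sign when t < t0. *)
Definition oriented_integral (R : realType) (f : R -> R) (t0 t : R) : R :=
  if t0 <= t then \int[@lebesgue_measure R]_(s in `[t0, t]) f s
  else - \int[@lebesgue_measure R]_(s in `[t, t0]) f s.

(* Main.v *)
Require Import Defs.
From HB Require Import structures.
From mathcomp Require Import all_boot all_order all_algebra.
From mathcomp Require Import all_classical all_reals all_analysis.
From mathcomp Require Import ring.
Set Implicit Arguments.
Unset Strict Implicit.
Unset Printing Implicit Defensive.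
Import Order.TTheory GRing.Theory Num.Theory.
Import numFieldNormedType.Exports.
Local Open Scope classical_set_scope.
Local Open Scope ring_scope.

(** Fix a chart.  The components of the solution and of its time derivatives,
    together with their coordinate derivatives, generate a ring of functions on
    (time interval) x (chart) in which the inverse metric lives and on which
    d/dt and the coordinate derivatives are commuting derivations: for two
    coordinates this is Schwarz's theorem, and for time and a coordinate it is
    the convergence of difference quotients in the Frechet topology.  The rest
    is differential algebra in that ring.  Put K = g^-1 g'; the evolution
    equation reads
      K' = - (tr K / 2) K + 2 alpha Ric + phi Id
    with a scalar phi.  Together with the contracted Bianchi identity
    div Ric = d tau / 2 this gives
      (delta^- g')' = - (tr K / 2) delta^- g',
    and with the variation tau' = - tr (K Ric) - div (delta^- g') it gives,
    when delta^- g' = 0,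
      H' = - (tr K / 2) H.
    At each point these are scalar linear equations in t.  Since
    (log |det g|)' = tr K, their solution is explicit and the second one is
    inverse to sqrt (det g). *)

(** * Derivations of a commutative ring, on matrices and determinants *)

Section Derivations.
Variables (B : comPzRingType) (d : {additive B -> B}).
Hypothesis dM : forall x y, d (x * y) = d x * y + x * d y.

Lemma derivation1 : d 1 = 0.
Proof.
have := dM 1 1; rewrite !mulr1 mul1r => /eqP.
by rewrite -subr_eq0 opprD addrA subrr add0r oppr_eq0 => /eqP.
Qed.

Lemma derivation_nat m : d m%:R = 0.
Proof. by rewrite raddfMn derivation1 mul0rn. Qed.

Lemma derivation_inv_nat m x : m%:R * x = 1 -> d x = 0.
Proof.
move=> mx1; have: d (m%:R * x) = 0 by rewrite mx1 derivation1.
rewrite dM derivation_nat mul0r add0r => /(congr1 (fun y => x * y)).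
by rewrite mulrA (mulrC x) mx1 mul1r mulr0.
Qed.

Lemma map_derivationM m p q (X : 'M[B]_(m, p)) (Y : 'M[B]_(p, q)) :
  map_mx d (X *m Y) = map_mx d X *m Y + X *m map_mx d Y.
Proof.
apply/matrixP => i j; rewrite !mxE raddf_sum -big_split.
by apply: eq_bigr => k _; rewrite dM !mxE.
Qed.

Lemma derivation_mxtrace m (X : 'M[B]_m) : d (\tr X) = \tr (map_mx d X).
Proof. by rewrite /mxtrace raddf_sum; apply: eq_bigr => k _; rewrite !mxE. Qed.

Lemma derivation_prod (I : finType) (f : I -> B) :
  d (\prod_i f i) = \sum_i d (f i) * \prod_(j | j != i) f j.
Proof.
(* Induction runs over duplicate-free lists: the condition [j != i] drops every occurrence of [i] at
   once. *)
suff H (s : seq I) : uniq s -> d (\prod_(i <- s) f i) =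
    \sum_(i <- s) d (f i) * \prod_(j <- s | j != i) f j.
  by have := H (index_enum I) (index_enum_uniq I).
elim: s => [_|x s IHs /= /andP[xs us]]; first by rewrite !big_nil derivation1.
rewrite !big_cons dM IHs // eqxx; congr (_ * _ + _).
  by rewrite [RHS]big_seq_cond [LHS]big_seq_cond; apply: eq_bigl => i;
     rewrite andbT; case: (boolP (i \in s)) => //= h; apply/esym;
     apply: contraNneq xs => <-.
rewrite big_distrr big_seq [RHS]big_seq; apply: eq_bigr => i si.
rewrite big_cons; case: eqP => [xi|_] /=; first by rewrite xi si in xs.
by rewrite mulrCA.
Qed.

(** Jacobi's formula: by multilinearity the derivative is a sum of determinants with one row
    differentiated, and expanding along that row produces cofactors of [X]. *)
Lemma derivation_det m (X : 'M[B]_m) :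
  d (\det X) = \tr (map_mx d X *m \adj X).
Proof.
pose Xr i := \matrix_(k, j) (if k == i then d (X k j) else X k j).
transitivity (\sum_i \det (Xr i)).
  rewrite /determinant raddf_sum exchange_big; apply: eq_bigr => s _.
  rewrite -big_distrr -signr_odd; case: (odd _) => /=.
    rewrite expr1 !mulN1r raddfN; congr (- _).
    rewrite derivation_prod; apply: eq_bigr => i _.
    rewrite [in RHS](bigD1 i) //= !mxE eqxx; congr (_ * _).
    by apply: eq_bigr => j /negbTE ji; rewrite !mxE ji.
  rewrite expr0 !mul1r derivation_prod; apply: eq_bigr => i _.
  rewrite [in RHS](bigD1 i) //= !mxE eqxx; congr (_ * _).
  by apply: eq_bigr => j /negbTE ji; rewrite !mxE ji.
rewrite /mxtrace; apply: eq_bigr => i _.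
rewrite (expand_det_row _ i) mxE; apply: eq_bigr => j _.
rewrite !mxE eqxx; congr (_ * _); rewrite /cofactor; congr (_ * \det _).
by apply/matrixP => k l; rewrite !mxE eq_sym (negbTE (neq_lift _ _)).
Qed.

End Derivations.

(** Unlike [mxE], these entry rules stop at products, so that [ring] can treat entries of matrix
    products as atoms. *)
Lemma addmxE (B : comPzRingType) m p (X Y : 'M[B]_(m, p)) i j :
  (X + Y) i j = X i j + Y i j.
Proof. by rewrite mxE. Qed.

Lemma oppmxE (B : comPzRingType) m p (X : 'M[B]_(m, p)) i j :
  (- X) i j = - X i j.
Proof. by rewrite mxE. Qed.

Lemma scalemxE (B : comPzRingType) m p x (X : 'M[B]_(m, p)) i j :
  (x *: X) i j = x * X i j.
Proof. by rewrite mxE. Qed.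

(** * Torsion-free metric connections over a differential ring *)

Section Connection.
Variables (B : comPzRingType) (n : nat) (d : option 'I_n -> {additive B -> B}).
Hypothesis dM : forall i x y, d i (x * y) = d i x * y + x * d i y.
Hypothesis dC : forall i j x, d i (d j x) = d j (d i x).
Variable half : B.
Hypothesis half2 : half + half = 1.

(** The index [Some i] is the i-th coordinate direction and [None] is time. *)
Definition dx i m p (X : 'M[B]_(m, p)) := map_mx (d (Some i)) X.
Definition dt m p (X : 'M[B]_(m, p)) := map_mx (d None) X.
Arguments dx i {m p} X.
Arguments dt {m p} X.

Lemma dxM i m p q (X : 'M[B]_(m, p)) (Y : 'M[B]_(p, q)) :
  dx i (X *m Y) = dx i X *m Y + X *m dx i Y.
Proof. exact: map_derivationM. Qed.

Lemma dtM m p q (X : 'M[B]_(m, p)) (Y : 'M[B]_(p, q)) :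
  dt (X *m Y) = dt X *m Y + X *m dt Y.
Proof. exact: map_derivationM. Qed.

Lemma dxD i m p (X Y : 'M[B]_(m, p)) : dx i (X + Y) = dx i X + dx i Y.
Proof. exact: map_mxD. Qed.
Lemma dxN i m p (X : 'M[B]_(m, p)) : dx i (- X) = - dx i X.
Proof. exact: map_mxN. Qed.
Lemma dtD m p (X Y : 'M[B]_(m, p)) : dt (X + Y) = dt X + dt Y.
Proof. exact: map_mxD. Qed.
Lemma dtN m p (X : 'M[B]_(m, p)) : dt (- X) = - dt X.
Proof. exact: map_mxN. Qed.

Lemma dx_tr i m p (X : 'M[B]_(m, p)) : dx i X^T = (dx i X)^T.
Proof. by rewrite /dx map_trmx. Qed.
Lemma dt_tr m p (X : 'M[B]_(m, p)) : dt X^T = (dt X)^T.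
Proof. by rewrite /dt map_trmx. Qed.

Lemma dxC i j m p (X : 'M[B]_(m, p)) : dx i (dx j X) = dx j (dx i X).
Proof. by apply/matrixP => k l; rewrite !mxE dC. Qed.
Lemma dxdt i m p (X : 'M[B]_(m, p)) : dx i (dt X) = dt (dx i X).
Proof. by apply/matrixP => k l; rewrite !mxE dC. Qed.

Lemma dxtrace i m (X : 'M[B]_m) : d (Some i) (\tr X) = \tr (dx i X).
Proof. exact: derivation_mxtrace. Qed.
Lemma dttrace m (X : 'M[B]_m) : d None (\tr X) = \tr (dt X).
Proof. exact: derivation_mxtrace. Qed.

Lemma eq_opp_eq0 (x : B) : x = - x -> x = 0.
Proof.
move=> xN; have xx0 : x + x = 0 by rewrite [X in X + _]xN addNr.
by rewrite -[x]mul1r -half2 mulrDl -mulrDr xx0 mulr0.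
Qed.

Lemma sum_antisym (f : 'I_n -> 'I_n -> B) :
  (forall i j, f i j = - f j i) -> \sum_i \sum_j f i j = 0.
Proof.
move=> fN; apply: eq_opp_eq0; rewrite [LHS]exchange_big -sumrN.
by apply: eq_bigr => i _; rewrite -sumrN; apply: eq_bigr => j _.
Qed.

(* [G] is the inverse metric and [A i l k] the Christoffel symbol
   Gamma^l_ik. *)
Variables (G : 'M[B]_n) (A : 'I_n -> 'M[B]_n).
Hypothesis Gsym : G^T = G.
Hypothesis Asym : forall i l k, A i l k = A k l i.
Hypothesis dxG : forall i, dx i G = - (A i *m G + G *m (A i)^T).

(** Commutator of the operators d_i + A_i on vector fields; entry (l, k) is the coefficient of d_l
    in R(d_i, d_j) d_k. [Asym] expresses zero torsion and [dxG] that the inverse metric is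
    parallel. *)
Definition curv i j := dx i (A j) - dx j (A i) + (A i *m A j - A j *m A i).

Lemma curvN i j : curv i j = - curv j i.
Proof. by apply/matrixP => k l; rewrite /curv !(addmxE, oppmxE); ring. Qed.

(** First Bianchi identity: zero torsion exchanges the last matrix index with the index of the
    connection, and the terms then cancel in pairs. *)
Lemma curv_bianchi1 i j k l : curv i j l k + curv j k l i + curv k i l j = 0.
Proof.
have dA a b c e : (dx a (A b)) c e = (dx a (A e)) c b by rewrite !mxE Asym.
have AA a b c e : (A a *m A b) c e = (A a *m A e) c b.
  by rewrite !mxE; apply: eq_bigr => m _; rewrite (Asym b).
rewrite /curv !(addmxE, oppmxE) (dA i k) (dA j i) (dA k j).
by rewrite (AA i k) (AA j i) (AA k j); ring.
Qed.

(** Second Bianchi identity, that is, the Jacobi identity for the operators d_i + A_i. Christoffel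
    terms for the two form indices are left out: without torsion they cancel in the cyclic sum. *)
Lemma curv_bianchi2 i j k :
  dx i (curv j k) + (A i *m curv j k - curv j k *m A i)
  + (dx j (curv k i) + (A j *m curv k i - curv k i *m A j))
  + (dx k (curv i j) + (A k *m curv i j - curv i j *m A k)) = 0.
Proof.
rewrite /curv !(dxD, dxN, dxM, mulmxDl, mulmxDr, mulmxN, mulNmx, mulmxA).
rewrite (dxC j i) (dxC k i) (dxC k j).
apply/matrixP => a b; rewrite [RHS]mxE !(addmxE, oppmxE). ring.
Qed.

(** Raising the lower matrix index turns metric compatibility into antisymmetry in the two matrix
    indices. *)
Definition rcurv i j := curv i j *m G.

Lemma rcurvN i j : rcurv i j = - rcurv j i.
Proof. by rewrite /rcurv curvN mulNmx. Qed.

(** As [G] is parallel, equality of its mixed second derivatives says that F G + G F^T = 0 for the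
    curvature F. *)
Lemma rcurv_tr i j : (rcurv i j)^T = - rcurv i j.
Proof.
have := dxC i j G; rewrite !dxG.
rewrite !(dxD, dxN, dxM, dxG, dx_tr, mulmxDl, mulmxDr, mulmxN, mulNmx).
rewrite !mulmxA => H.
rewrite /rcurv trmx_mul Gsym /curv.
rewrite !(linearD, linearN) /= !trmx_mul.
rewrite !(mulmxDl, mulmxDr, mulmxN, mulNmx, mulmxA).
apply/matrixP => a b; move/matrixP: H => /(_ a b).
rewrite !(addmxE, oppmxE) => H.
apply/eqP; rewrite -subr_eq0; apply/eqP; rewrite -[RHS]oppr0.
by move/eqP: H; rewrite -subr_eq0 => /eqP <-; ring.
Qed.

Lemma rcurv_asym i j k l : rcurv i j k l = - rcurv i j l k.
Proof.
have := congr1 (fun X : 'M[B]_n => X l k) (rcurv_tr i j).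
by rewrite mxE oppmxE.
Qed.

Lemma rcurv_bianchi2 i j k :
  dx i (rcurv j k) + (A i *m rcurv j k + rcurv j k *m (A i)^T)
  + (dx j (rcurv k i) + (A j *m rcurv k i + rcurv k i *m (A j)^T))
  + (dx k (rcurv i j) + (A k *m rcurv i j + rcurv i j *m (A k)^T)) = 0.
Proof.
have H a b c : dx a (rcurv b c) + (A a *m rcurv b c + rcurv b c *m (A a)^T)
    = (dx a (curv b c) + (A a *m curv b c - curv b c *m A a)) *m G.
  rewrite /rcurv dxM dxG !(mulmxDl, mulmxDr, mulmxN, mulNmx, mulmxA).
  by apply/matrixP => u v; rewrite !(addmxE, oppmxE); ring.
by rewrite !H -!mulmxDl curv_bianchi2 mul0mx.
Qed.

(* [rho k b] is the Ricci tensor with its second index raised. *)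
Definition rho k b := \sum_i rcurv i k i b.
Definition tau := \sum_j rho j j.

(* The divergence of the endomorphism field [X], with [X i j] = X^i_j. *)
Definition divmx (X : 'M[B]_n) j :=
  \sum_i (dx i X + A i *m X - X *m A i) i j.

Lemma sum_symasym (f h : 'I_n -> 'I_n -> B) :
  (forall i j, f i j = f j i) -> (forall i j, h i j = - h j i) ->
  \sum_i \sum_j f i j * h i j = 0.
Proof.
by move=> fS hA; apply: sum_antisym => i j; rewrite fS hA mulrN.
Qed.

(** Take entry (i, j) of the second Bianchi identity for the directions i, j, k and sum over i and
    j. *)
Lemma contracted_bianchi k :
  d (Some k) tau = 2 * divmx (\matrix_(i, j) rho j i) k.
Proof.
(* The divergence is X + Y - Z, and the nine contracted sums are -X, -Y, 0, -X, 0, -Y, d_k tau, Z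
   and Z. The zeros pair a symmetric Christoffel symbol with an antisymmetric curvature. *)
pose X := \sum_i d (Some i) (rho k i).
pose Y := \sum_i \sum_m A i i m * rho k m.
pose Z := \sum_i \sum_m A k i m * rho i m.
have dE i j k' a b : (dx i (rcurv j k')) a b = d (Some i) (rcurv j k' a b).
  by rewrite mxE.
have divE : divmx (\matrix_(i, j) rho j i) k = X + Y - Z.
  rewrite /divmx (eq_bigr (fun i => d (Some i) (rho k i)
     + \sum_m A i i m * rho k m - \sum_m rho m i * A i m k)); last first.
    move=> i _; rewrite !(addmxE, oppmxE); congr (_ + _ - _).
    - by rewrite !mxE.
    - by rewrite !mxE; apply: eq_bigr => m _; rewrite mxE.
    - by rewrite !mxE; apply: eq_bigr => m _; rewrite mxE.
  rewrite big_split big_split /= sumrN; congr (_ + _ - _).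
  rewrite exchange_big; apply: eq_bigr => i _; apply: eq_bigr => m _.
  by rewrite mulrC Asym.
have H i j : d (Some i) (rcurv j k i j)
    + ((A i *m rcurv j k) i j + (rcurv j k *m (A i)^T) i j)
  + (d (Some j) (rcurv k i i j)
    + ((A j *m rcurv k i) i j + (rcurv k i *m (A j)^T) i j))
  + (d (Some k) (rcurv i j i j)
    + ((A k *m rcurv i j) i j + (rcurv i j *m (A k)^T) i j)) = 0.
  by move/matrixP: (rcurv_bianchi2 i j k) => /(_ i j);
     rewrite !addmxE !dE [RHS]mxE.
have : \sum_i \sum_j (d (Some i) (rcurv j k i j)
    + ((A i *m rcurv j k) i j + (rcurv j k *m (A i)^T) i j)
  + (d (Some j) (rcurv k i i j)
    + ((A j *m rcurv k i) i j + (rcurv k i *m (A j)^T) i j))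
  + (d (Some k) (rcurv i j i j)
    + ((A k *m rcurv i j) i j + (rcurv i j *m (A k)^T) i j))) = 0.
  by apply: big1 => i _; apply: big1 => j _.
under eq_bigr do rewrite !big_split /=.
rewrite !big_split /=.
have -> : \sum_i \sum_j d (Some i) (rcurv j k i j) = - X.
  rewrite /X -sumrN; apply: eq_bigr => i _; rewrite -raddfN /rho -sumrN.
  by rewrite raddf_sum; apply: eq_bigr => j _; rewrite rcurv_asym.
have -> : \sum_i \sum_j (A i *m rcurv j k) i j = - Y.
  rewrite /Y -sumrN; apply: eq_bigr => i _.
  under eq_bigr do rewrite mxE.
  rewrite exchange_big -sumrN; apply: eq_bigr => m _.
  rewrite -big_distrr -mulrN /rho -sumrN; congr (_ * _).
  by apply: eq_bigr => j _; rewrite rcurv_asym.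
have -> : \sum_i \sum_j (rcurv j k *m (A i)^T) i j = 0.
  rewrite exchange_big big1 // => j _.
  under eq_bigr do rewrite mxE.
  rewrite -[RHS](@sum_symasym (fun i m => A i j m) (rcurv j k)).
  - by apply: eq_bigr => i _; apply: eq_bigr => m _; rewrite [_^T _ _]mxE mulrC.
  - by move=> i m; rewrite Asym.
  - exact: rcurv_asym.
have -> : \sum_i \sum_j d (Some j) (rcurv k i i j) = - X.
  rewrite exchange_big /X -sumrN; apply: eq_bigr => j _.
  rewrite -raddfN /rho -sumrN raddf_sum; apply: eq_bigr => i _.
  by rewrite rcurvN oppmxE.
have -> : \sum_i \sum_j (A j *m rcurv k i) i j = 0.
  rewrite big1 // => i _.
  under eq_bigr do rewrite mxE.
  rewrite -[RHS](@sum_symasym (fun j m => A j i m)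
                  (fun j m => rcurv k i m j)).
  - by [].
  - by move=> j m; rewrite Asym.
  - by move=> j m; rewrite rcurv_asym.
have -> : \sum_i \sum_j (rcurv k i *m (A j)^T) i j = - Y.
  rewrite exchange_big /Y -sumrN; apply: eq_bigr => j _.
  under eq_bigr do rewrite mxE.
  rewrite exchange_big -sumrN; apply: eq_bigr => m _.
  rewrite -mulrN /rho -sumrN mulr_sumr; apply: eq_bigr => i _.
  by rewrite [_^T _ _]mxE (rcurvN k i) oppmxE mulrC.
have -> : \sum_i \sum_j d (Some k) (rcurv i j i j) = d (Some k) tau.
  rewrite /tau raddf_sum exchange_big; apply: eq_bigr => j _.
  by rewrite /rho raddf_sum.
have -> : \sum_i \sum_j (A k *m rcurv i j) i j = Z.
  rewrite /Z; apply: eq_bigr => i _.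
  under eq_bigr do rewrite mxE.
  rewrite exchange_big; apply: eq_bigr => m _.
  rewrite -mulr_sumr /rho; congr (_ * _); apply: eq_bigr => j _.
  by rewrite (rcurvN i j) oppmxE (rcurv_asym j i m j) opprK.
have -> : \sum_i \sum_j (rcurv i j *m (A k)^T) i j = Z.
  rewrite exchange_big /Z; apply: eq_bigr => j _.
  under eq_bigr do rewrite mxE.
  rewrite exchange_big; apply: eq_bigr => m _.
  rewrite /rho mulr_sumr; apply: eq_bigr => i _.
  by rewrite [_^T _ _]mxE mulrC.
rewrite divE => E; apply/eqP; rewrite -subr_eq0; apply/eqP.
by rewrite -[RHS]E; ring.
Qed.

End Connection.

(** * Evolution of the momentum and of the Hamiltonian *)

Section MetricEvolution.
Variables (B : comPzRingType) (n : nat) (d : option 'I_n -> {additive B -> B}).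
Hypothesis dM : forall i x y, d i (x * y) = d i x * y + x * d i y.
Hypothesis dC : forall i j x, d i (d j x) = d j (d i x).
Variable half : B.
Hypothesis half2 : half + half = 1.
Variables (g G : 'M[B]_n) (A : 'I_n -> 'M[B]_n).
Hypothesis gsym : g^T = g.
Hypothesis gG : g *m G = 1%:M.
Hypothesis Gg : G *m g = 1%:M.
Hypothesis Asym : forall i l k, A i l k = A k l i.
Hypothesis dxg : forall i, dx d i g = (A i)^T *m g + g *m A i.

Let Gsym : G^T = G.
Proof.
have : G^T *m g = 1%:M by rewrite -[g in LHS]gsym -trmx_mul gG trmx1.
by move=> /(congr1 (fun X => X *m G)); rewrite -mulmxA gG mulmx1 mul1mx.
Qed.

Lemma derivation_inverse i : map_mx (d i) G = - (G *m map_mx (d i) g *m G).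
Proof.
have d1 : map_mx (d i) (1%:M : 'M[B]_n) = 0.
  apply/matrixP => a b; rewrite !mxE; case: (a == b); rewrite ?mulr1n ?mulr0n.
    exact: (derivation1 (dM i)).
  by rewrite raddf0.
have := congr1 (fun X => G *m map_mx (d i) X) gG.
rewrite d1 map_derivationM // mulmxDr mulmxA [in X in _ + X]mulmxA Gg mul1mx.
by rewrite mulmx0 addrC => /eqP; rewrite addr_eq0 => /eqP.
Qed.

Let dxG i : dx d i G = - (A i *m G + G *m (A i)^T).
Proof.
rewrite [LHS]derivation_inverse -/(dx d i g) dxg mulmxDr mulmxDl.
by rewrite !mulmxA Gg mul1mx -!mulmxA gG mulmx1 addrC.
Qed.

Definition ric : 'M[B]_n := \matrix_(j, k) \sum_i curv d A i j i k.

(** By the contracted first Bianchi identity the antisymmetric part of [ric] is a trace of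
    curvature. That trace vanishes, being the trace of an antisymmetric matrix times the symmetric
    [g]. *)
Lemma ric_tr : ric^T = ric.
Proof.
apply/matrixP => k j; rewrite !mxE; apply/eqP; rewrite -subr_eq0.
have trF : \tr (curv d A k j) = 0.
  have -> : curv d A k j = rcurv d G A k j *m g.
    by rewrite /rcurv -mulmxA Gg mulmx1.
  apply: (eq_opp_eq0 half2); rewrite -[LHS]mxtrace_tr trmx_mul gsym.
  by rewrite rcurv_tr // mulmxN raddfN /= mxtrace_mulC.
apply/eqP; rewrite -[RHS]trF -sumrB /mxtrace.
apply/eqP; rewrite -subr_eq0 -sumrB; apply/eqP; apply: big1 => i _.
have := curv_bianchi1 d Asym i j k i.
rewrite (curvN d A k i) (curvN d A j k) !oppmxE => H.
by rewrite -[RHS]H; ring.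
Qed.

Definition ricsharp : 'M[B]_n := G *m ric.

(** Symmetry of [ric] makes it irrelevant which index is raised, which brings [ricsharp] under the
    contracted Bianchi identity. *)
Lemma ricsharpE : ricsharp = \matrix_(i, j) rho d G A j i.
Proof.
rewrite /ricsharp -[LHS]trmxK trmx_mul ric_tr Gsym.
apply/matrixP => i j; rewrite !mxE.
under eq_bigr do rewrite mxE mulr_suml.
rewrite exchange_big /rho; apply: eq_bigr => l _; by rewrite mxE.
Qed.

Definition scalar_curv : B := \tr ricsharp.

Lemma scalar_curvE : scalar_curv = tau d G A.
Proof.
by rewrite /scalar_curv ricsharpE; apply: eq_bigr => i _; rewrite mxE.
Qed.

Lemma div_ricsharp k :
  d (Some k) scalar_curv = 2 * divmx d A ricsharp k.
Proof.
by rewrite scalar_curvE ricsharpE; exact: (contracted_bianchi dM dC half2 Gsym).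
Qed.

(** [k] is the velocity g', [K] the associated endomorphism, and [C i] the variation of the
    connection, a tensor although [A i] is not. *)
Let k := dt d g.
Let K := G *m k.
Let C i := dt d (A i).

Let Csym i l m : C i l m = C m l i.
Proof. by rewrite !mxE Asym. Qed.

Let ksym : k^T = k.
Proof. by rewrite /k -dt_tr gsym. Qed.

Let dxk i :
  dx d i k = (C i)^T *m g + (A i)^T *m k + (k *m A i + g *m C i).
Proof. by rewrite /k dxdt // dxg dtD !dtM // dt_tr. Qed.

(** Metric compatibility differentiated in time, with an index raised; the left side is the
    covariant derivative of [K]. *)
Lemma nabla_velocity i :
  dx d i K + A i *m K - K *m A i = G *m (C i)^T *m g + C i.
Proof.
rewrite /K dxM // dxG dxk !(mulmxDl, mulmxDr, mulmxN, mulNmx, mulmxA) Gg.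
by rewrite mul1mx; apply/matrixP => a b; rewrite !(addmxE, oppmxE); ring.
Qed.

Lemma dx_tr_velocity i : d (Some i) (\tr K) = 2 * \tr (C i).
Proof.
have := congr1 mxtrace (nabla_velocity i).
rewrite raddfB !raddfD /= (mxtrace_mulC K) addrK dxtrace // => ->.
by rewrite -mulmxA mxtrace_mulC -mulmxA gG mulmx1 mxtrace_tr; ring.
Qed.

(** [K] is self-adjoint for [g], so both terms of [nabla_velocity] have the same trace against
    [K]. *)
Lemma dx_tr_velocity2 i : d (Some i) (\tr (K *m K)) = 4 * \tr (K *m C i).
Proof.
have -> : d (Some i) (\tr (K *m K)) = 2 * \tr (K *m dx d i K).
  by rewrite dxtrace // dxM // raddfD /= mxtrace_mulC; ring.
have /eqP := nabla_velocity i.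
rewrite subr_eq => /eqP /(canRL (addrK _)) ->.
rewrite mulmxBr !mulmxDr raddfB !raddfD /=.
have -> : \tr (K *m (G *m (C i)^T *m g)) = \tr (K *m C i).
  rewrite mxtrace_mulC /K -!mulmxA (mulmxA g) gG mul1mx -[LHS]mxtrace_tr.
  by rewrite !trmx_mul trmxK ksym Gsym mxtrace_mulC.
rewrite (mxtrace_mulC K (K *m A i)) -(mulmxA K (A i)); ring.
Qed.

(* Component j of delta^- applied to the velocity [k] of the metric. *)
Definition div_velocity j : B := - divmx d A K j + d (Some j) (\tr K).

Lemma sum_dt_connection m : \sum_i C i i m = half * d (Some m) (\tr K).
Proof.
rewrite dx_tr_velocity mulrA mulr_natr mulr2n half2 mul1r.
by apply: eq_bigr => i _; rewrite Csym.
Qed.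

Lemma dt_divmx (X : 'M[B]_n) j : d None (divmx d A X j) =
  divmx d A (dt d X) j + \sum_i (C i *m X - X *m C i) i j.
Proof.
rewrite /divmx raddf_sum -big_split /=; apply: eq_bigr => i _.
have -> (Y : 'M[B]_n) a b : d None (Y a b) = dt d Y a b by rewrite mxE.
rewrite !(dtD, dtN, dtM) // -dxdt //; rewrite !(addmxE, oppmxE).
by rewrite -/(C i); ring.
Qed.

(** The variation of the connection adds two contractions. By symmetry of [C], sum_i C_i K is half
    the pairing of d tr K with K, and sum_i K C_i is tr (K C_j), a quarter of d_j tr (K^2). *)
Lemma dt_div_velocity j : d None (div_velocity j) =
  - divmx d A (dt d K) j - half * (\sum_m d (Some m) (\tr K) * K m j)
  + half * half * d (Some j) (\tr (K *m K)) + d (Some j) (\tr (dt d K)).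
Proof.
rewrite /div_velocity raddfD raddfN /= dt_divmx dC dttrace // dx_tr_velocity2.
have -> : \sum_i (C i *m K - K *m C i) i j =
    half * (\sum_m d (Some m) (\tr K) * K m j) - \tr (K *m C j).
  have -> : \sum_i (C i *m K - K *m C i) i j =
      \sum_i (C i *m K) i j - \sum_i (K *m C i) i j.
    by rewrite -sumrB; apply: eq_bigr => i _; rewrite !(addmxE, oppmxE).
  congr (_ - _).
    under eq_bigr do rewrite mxE.
    rewrite exchange_big mulr_sumr; apply: eq_bigr => m _.
    by rewrite -mulr_suml sum_dt_connection mulrA.
  rewrite /mxtrace; apply: eq_bigr => i _; rewrite !mxE.
  by apply: eq_bigr => m _; rewrite Csym.
have -> : half * half * (4 * \tr (K *m C j)) = \tr (K *m C j).
  transitivity ((half + half) * (half + half) * \tr (K *m C j)); first by ring.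
  by rewrite half2 !mul1r.
by ring.
Qed.

(** In the first variation of scalar curvature, the terms in [C] form the divergence of a vector
    field [W], which the constraint annihilates. *)
Lemma dt_scalar_curv : (forall j, div_velocity j = 0) ->
  d None scalar_curv = - \tr (ricsharp *m K).
Proof.
move=> D0; rewrite scalar_curvE.
pose E i := C i *m G.
pose W m := \sum_i E i m i - \sum_i E i i m.
(* [W] is minus delta^- g' with its index raised. *)
have W0 m : W m = 0.
  have D j : div_velocity j = \sum_i C i i j - \sum_i (G *m (C i)^T *m g) i j.
    rewrite /div_velocity /divmx; under eq_bigr do rewrite nabla_velocity.
    under eq_bigr do rewrite addmxE.
    rewrite big_split /= -[d _ _]mul1r -half2 mulrDl -!sum_dt_connection; ring.
  have : - (\sum_j div_velocity j * G j m) = 0.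
    by rewrite big1 ?oppr0 // => j _; rewrite D0 mul0r.
  under eq_bigr do rewrite D mulrBl !mulr_suml.
  rewrite sumrB opprB => <-; rewrite /W; congr (_ - _).
    rewrite exchange_big; apply: eq_bigr => i _ /=.
    transitivity ((G *m (C i)^T *m g *m G) i m); last by rewrite mxE.
    by rewrite -mulmxA gG mulmx1 -[in RHS]Gsym -trmx_mul [RHS]mxE.
  rewrite exchange_big; apply: eq_bigr => i _.
  by rewrite /E [LHS]mxE.
(* Palatini identity: the curvature varies by nabla_i C_j - nabla_j C_i. Multiplication by [G]
   replaces [C] by [E], and the last term is the variation of [G]. *)
have dtP i j : dt d (rcurv d G A i j) =
    dx d i (E j) + (A i *m E j + E j *m (A i)^T)
    - (dx d j (E i) + (A j *m E i + E i *m (A j)^T))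
    - rcurv d G A i j *m (k *m G).
  rewrite /E /rcurv dtM // !(dxM dM) !dxG /curv !(dtD, dtN, dtM dM).
  rewrite -!dxdt // -/(C i) -/(C j) [dt d G]derivation_inverse -/(dt d g) -/k.
  rewrite !(mulmxDl, mulmxDr, mulmxN, mulNmx, mulmxA).
  by apply/matrixP => a b; rewrite !(addmxE, oppmxE); ring.
have -> : d None (tau d G A) = \sum_j \sum_i (dt d (rcurv d G A i j)) i j.
  rewrite /tau raddf_sum; apply: eq_bigr => j _.
  by rewrite raddf_sum; apply: eq_bigr => i _; rewrite [RHS]mxE.
under eq_bigr do under eq_bigr do rewrite dtP !(addmxE, oppmxE).
under eq_bigr do rewrite !(big_split, sumrN) /=.
rewrite !(big_split, sumrN) /=.
have -> : \sum_j \sum_i (rcurv d G A i j *m (k *m G)) i j =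
    \tr (ricsharp *m K).
  rewrite ricsharpE -[RHS]mxtrace_tr trmx_mul mxtrace_mulC /K.
  rewrite trmx_mul ksym Gsym.
  apply: eq_bigr => j _; rewrite [RHS]mxE.
  under eq_bigr do rewrite mxE.
  rewrite exchange_big; apply: eq_bigr => m _ /=.
  by rewrite -mulr_suml !mxE.
rewrite -[RHS]add0r; congr (_ - _).
have -> : \sum_j \sum_i dx d i (E j) i j =
    \sum_i d (Some i) (\sum_j E j i j).
  rewrite exchange_big; apply: eq_bigr => i _; rewrite raddf_sum.
  by apply: eq_bigr => j _; rewrite mxE.
have -> : \sum_j \sum_i dx d j (E i) i j =
    \sum_i d (Some i) (\sum_j E j j i).
  apply: eq_bigr => i _; rewrite raddf_sum.
  by apply: eq_bigr => j _; rewrite mxE.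
have -> : \sum_j \sum_i (A i *m E j) i j =
    \sum_i \sum_m A i i m * \sum_j E j m j.
  rewrite exchange_big; apply: eq_bigr => i _ /=.
  under eq_bigr do rewrite mxE.
  rewrite exchange_big; apply: eq_bigr => m _ /=; by rewrite mulr_sumr.
have -> : \sum_j \sum_i (E i *m (A j)^T) i j =
    \sum_i \sum_m A i i m * \sum_j E j j m.
  apply: eq_bigr => i _ /=.
  under eq_bigr do rewrite mxE.
  rewrite exchange_big; apply: eq_bigr => m _ /=; rewrite mulr_sumr.
  by apply: eq_bigr => j _; rewrite [_^T _ _]mxE mulrC.
have -> : \sum_j \sum_i (A j *m E i) i j =
    \sum_j \sum_i (E j *m (A i)^T) i j.
  under eq_bigr do under eq_bigr do rewrite mxE.
  under [RHS]eq_bigr do under eq_bigr do rewrite mxE.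
  rewrite exchange_big; apply: eq_bigr => j _ /=; rewrite exchange_big.
  apply: eq_bigr => i _ /=; apply: eq_bigr => m _.
  by rewrite (Asym m) [_^T _ _]mxE mulrC.
(* Since [W] vanishes, the two contractions of [E] agree, and the remaining divergence terms
   cancel. *)
have XY m : \sum_j E j m j = \sum_j E j j m.
  by apply/eqP; rewrite -subr_eq0; apply/eqP; exact: W0.
have -> : \sum_i d (Some i) (\sum_j E j i j) =
    \sum_i d (Some i) (\sum_j E j j i).
  by apply: eq_bigr => i _; rewrite XY.
have -> : \sum_i \sum_m A i i m * \sum_j E j m j =
    \sum_i \sum_m A i i m * \sum_j E j j m.
  by apply: eq_bigr => i _; apply: eq_bigr => m _; rewrite XY.
by ring.
Qed.

(** [c] is the inverse of n - 1; [al] and [la] stand for the constants alpha and lambda. *)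
Variables (c al la : B).
Hypothesis nc : (n%:R - 1) * c = 1.
Hypothesis d_al : forall i, d i al = 0.
Hypothesis d_la : forall i, d i la = 0.

(** As [G] is parallel, the index may be raised after differentiating; this is the coordinate form
    of delta^-. *)
Lemma div_velocityE j : div_velocity j =
  - (\sum_i (G *m (dx d i k - (A i)^T *m k - k *m A i)) i j)
  + d (Some j) (\tr K).
Proof.
rewrite /div_velocity /divmx; congr (- _ + _); apply: eq_bigr => i _.
congr (fun_of_matrix _ i j).
rewrite {1}/K dxM // dxG !(mulmxDr, mulmxDl, mulmxN, mulNmx, mulmxA) -/K.
by apply/matrixP => a b; rewrite !(addmxE, oppmxE); ring.
Qed.

Lemma dt_det : d None (\det g) = \tr K * \det g.
Proof.
rewrite (derivation_det (dM None)) -/(dt d g) -/k.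
have -> : \adj g = \det g *: G.
  by rewrite -[LHS]mulmx1 -gG mulmxA mul_adj_mx mul_scalar_mx.
by rewrite -scalemxAr mxtraceZ mxtrace_mulC mulrC.
Qed.

Definition inner_velocity : B := \tr (K *m K) - \tr K * \tr K.

(** The evolution equation, [half * half * c] being 1/(4(n-1)) and [half * c] being 1/(2(n-1)). *)
Hypothesis dtk : dt d k = k *m G *m k - (half * \tr K) *: k
  - (half * half * c * inner_velocity) *: g
  - (2 * al) *: (- ric + (half * c * scalar_curv) *: g + (la * half) *: g).

(** Collects the multiples of [g], which become multiples of the identity in K'. *)
Let phi : B :=
  - (half * half * c * inner_velocity) - al * c * scalar_curv - al * la.

(** The derivative of [G] contributes -K^2, which cancels the quadratic term of Gamma^-. *)
Let dtK : dt d K =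
  - ((half * \tr K) *: K) + (2 * al) *: ricsharp + phi%:M.
Proof.
rewrite {1}/K dtM // [dt d G]derivation_inverse -/(dt d g) -/k dtk.
rewrite !(mulmxDr, mulmxN, mulNmx) -!scalemxAr !(mulmxDr, mulmxN).
rewrite -!scalemxAr -/K -/ricsharp Gg !mulmxA -/K.
rewrite -[phi%:M]scalemx1; apply/matrixP => a b.
rewrite !(addmxE, oppmxE, scalemxE) /phi; set x := 1%:M a b.
have h0 : half + half - 1 = 0 by rewrite half2 subrr.
(* [ring] cannot use half + half = 1, so a vanishing multiple of [half + half - 1] is inserted by
   hand. *)
rewrite -[RHS]subr0 -(mul0r ((al * c * scalar_curv + al * la) * x)) -h0.
by ring.
Qed.

Lemma divmxD (X Y : 'M[B]_n) j :
  divmx d A (X + Y) j = divmx d A X j + divmx d A Y j.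
Proof.
rewrite /divmx -big_split; apply: eq_bigr => i _ /=.
by rewrite dxD mulmxDr mulmxDl !(addmxE, oppmxE); ring.
Qed.

Lemma divmxZ x (X : 'M[B]_n) j :
  divmx d A (x *: X) j = \sum_i d (Some i) x * X i j + x * divmx d A X j.
Proof.
rewrite /divmx mulr_sumr -big_split; apply: eq_bigr => i _ /=.
have -> : dx d i (x *: X) = d (Some i) x *: X + x *: dx d i X.
  by apply/matrixP => a b; rewrite !mxE dM.
by rewrite -scalemxAr -scalemxAl !(addmxE, oppmxE, scalemxE); ring.
Qed.

Lemma divmx_scalar x j : divmx d A x%:M j = d (Some j) x.
Proof.
rewrite /divmx (bigD1 j) //= big1 ?addr0.
  by rewrite !mul_mx_scalar mul_scalar_mx addrK !mxE eqxx mulr1n.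
move=> i ij; rewrite mul_mx_scalar mul_scalar_mx addrK !mxE.
by rewrite (negbTE ij) mulr0n raddf0.
Qed.

Let d_half i : d i half = 0.
Proof.
apply: (derivation_inv_nat (dM i) (m := 2)).
by rewrite mulr_natl mulr2n.
Qed.

Let dZ i x y : d i x = 0 -> d i (x * y) = x * d i y.
Proof. by move=> x0; rewrite dM x0 mul0r add0r. Qed.

Let tr_dtK : \tr (dt d K) =
  - (half * \tr K * \tr K) + 2 * al * scalar_curv + n%:R * phi.
Proof.
rewrite dtK 2!mxtraceD raddfN /= !mxtraceZ mxtrace_scalar.
by rewrite -[phi *+ n]mulr_natl.
Qed.

(** Both evolution laws involve [phi] only through (n - 1) phi and its derivatives, and there [c]
    cancels. *)
Let nphi : (n%:R - 1) * phi =
  - (half * half * inner_velocity) - al * scalar_curv - (n%:R - 1) * (al * la).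
Proof.
rewrite /phi; transitivity (- ((n%:R - 1) * c * (half * half * inner_velocity))
  - (n%:R - 1) * c * (al * scalar_curv) - (n%:R - 1) * (al * la)).
  by ring.
by rewrite nc !mul1r.
Qed.

(** The coefficients of d_j tau cancel: -al from the Bianchi identity, 2 al from tr K' and -al from
    [phi]. So do the terms in d_j tr (K^2) and in the pairing of d tr K with K. *)
Lemma dt_div_velocity_evol j :
  d None (div_velocity j) = - (half * \tr K) * div_velocity j.
Proof.
have dphi : (n%:R - 1) * d (Some j) phi =
    - (half * half * d (Some j) (\tr (K *m K)))
    + 2 * half * half * \tr K * d (Some j) (\tr K)
    - al * d (Some j) scalar_curv.
  have dn1 : d (Some j) (n%:R - 1) = 0.
    by rewrite raddfB /= (derivation_nat (dM _)) (derivation1 (dM _)) subr0.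
  have := congr1 (d (Some j)) nphi; rewrite dZ // => ->.
  rewrite !raddfD !raddfN /=.
  rewrite -!mulrA !dZ // d_la !mulr0 subr0 /inner_velocity raddfB /= dM.
  by ring.
have h0 : half * half + half * half - half = 0.
  by rewrite -mulrDr half2 mulr1 subrr.
have dn : d (Some j) (n%:R * phi) = n%:R * d (Some j) phi.
  by rewrite dZ // (derivation_nat (dM _)).
have d2al : d (Some j) (2 * al) = 0.
  by rewrite dZ ?d_al ?mulr0 //; apply: (derivation_nat (dM _)).
have trE : d (Some j) (\tr (dt d K)) = - (2 * half * \tr K * d (Some j) (\tr K))
    + 2 * al * d (Some j) scalar_curv + n%:R * d (Some j) phi.
  rewrite tr_dtK 2!raddfD /= raddfN /= dn [in X in _ + X + _]dZ //.
  by rewrite -mulrA dZ // dM; ring.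
rewrite dt_div_velocity trE dtK 2!divmxD divmx_scalar -scaleNr !divmxZ.
have -> : \sum_i d (Some i) (- (half * \tr K)) * K i j =
    - (half * \sum_i d (Some i) (\tr K) * K i j).
  rewrite mulr_sumr -sumrN; apply: eq_bigr => i _.
  by rewrite raddfN /= dZ //; ring.
have -> : \sum_i d (Some i) (2 * al) * ricsharp i j = 0.
  apply: big1 => i _.
  by rewrite dZ ?d_al ?mulr0 ?mul0r //; apply: (derivation_nat (dM _)).
set S := \sum_m _.
have dphi' : n%:R * d (Some j) phi = d (Some j) phi
    - (half * half * d (Some j) (\tr (K *m K)))
    + 2 * half * half * \tr K * d (Some j) (\tr K)
    - al * d (Some j) scalar_curv.
  rewrite mulrBl mul1r in dphi; move/eqP: dphi.
  by rewrite subr_eq => /eqP ->; ring.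
rewrite dphi' (div_ricsharp j) /div_velocity add0r -[RHS]addr0.
rewrite -[X in _ = _ + X](mul0r (\tr K * d (Some j) (\tr K))) -h0.
by ring.
Qed.

Definition hamiltonian : B :=
  half * inner_velocity + 2 * al * (scalar_curv - la * (n%:R - 1)).

(** The kinetic part contributes 2 al tr (Ric K) and 2 al tau' its opposite; all other terms carry a
    factor tr K. *)
Lemma dt_hamiltonian : (forall j, div_velocity j = 0) ->
  d None hamiltonian = - (half * \tr K) * hamiltonian.
Proof.
move=> D0; have n1 := nphi.
have dn1 i : d i (n%:R - 1) = 0.
  by rewrite raddfB /= (derivation_nat (dM _)) (derivation1 (dM _)) subr0.
have d2al i : d i (2 * al) = 0.
  by rewrite dZ ?d_al ?mulr0 //; apply: (derivation_nat (dM _)).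
have dip : d None inner_velocity =
    2 * \tr (K *m dt d K) - 2 * \tr K * \tr (dt d K).
  rewrite /inner_velocity raddfB /= dM !dttrace // dtM // mxtraceD.
  by rewrite (mxtrace_mulC (dt d K)); ring.
have trKdtK : \tr (K *m dt d K) = - (half * \tr K * \tr (K *m K))
    + 2 * al * \tr (ricsharp *m K) + phi * \tr K.
  rewrite dtK 2!mulmxDr mulmxN -!scalemxAr mul_mx_scalar 2!mxtraceD raddfN /=.
  by rewrite !mxtraceZ (mxtrace_mulC ricsharp).
have -> : d None hamiltonian =
    half * d None inner_velocity + 2 * al * d None scalar_curv.
  have la0 : d None (la * (n%:R - 1)) = 0 by rewrite dZ // dn1 mulr0.
  have dS : d None (scalar_curv - la * (n%:R - 1)) = d None scalar_curv.
    by apply: etrans (raddfB _ _ _) _; rewrite la0 subr0.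
  rewrite /hamiltonian raddfD -dS; congr (_ + _); first exact: dZ.
  exact: dZ.
rewrite dt_scalar_curv // dip trKdtK tr_dtK.
have -> : n%:R * phi = phi - (half * half * inner_velocity)
    - al * scalar_curv - (n%:R - 1) * (al * la).
  by rewrite mulrBl mul1r in n1; move/eqP: n1; rewrite subr_eq => /eqP ->; ring.
have h0 : half + half - 1 = 0 by rewrite half2 subrr.
rewrite /hamiltonian -[RHS]addr0.
rewrite -[X in _ = _ + X](mul0r (2 * al * \tr (ricsharp *m K)
  + half * half * \tr K * inner_velocity)) -h0 /inner_velocity.
by ring.
Qed.

End MetricEvolution.

(** * The Levi-Civita connection over a differential ring *)

Section LeviCivita.
Variables (B : comPzRingType) (n : nat) (d : option 'I_n -> {additive B -> B}).
Variables (half : B) (g G : 'M[B]_n).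
Hypothesis half2 : half + half = 1.
Hypothesis gsym : g^T = g.
Hypothesis gG : g *m G = 1%:M.
Hypothesis Gg : G *m g = 1%:M.

Definition levi_civita (i : 'I_n) : 'M[B]_n :=
  G *m \matrix_(l, j) (half * (d (Some i) (g j l) + d (Some j) (g i l)
                               - d (Some l) (g i j))).

Let gE i j : g i j = g j i.
Proof. by rewrite -[in LHS]gsym mxE. Qed.

Lemma levi_civita_sym i l k : levi_civita i l k = levi_civita k l i.
Proof.
rewrite !mxE; apply: eq_bigr => m _; rewrite !mxE; congr (_ * (_ * _)).
by rewrite (gE i k); ring.
Qed.

(** When the symbols of the first kind are added to their transpose, the derivatives in the other
    two directions cancel. *)
Lemma levi_civita_metric i :
  dx d i g = (levi_civita i)^T *m g + g *m levi_civita i.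
Proof.
rewrite /levi_civita trmx_mul -[in X in _ *m X + _]gsym -mulmxA -trmx_mul.
rewrite mulmxA gG mul1mx trmx1 mulmx1; apply/matrixP => l j; rewrite !mxE.
rewrite (gE l j); set u := d (Some i) _.
by rewrite -[LHS]mul1r -half2; ring.
Qed.

End LeviCivita.

(** * Differential rings of functions *)

Section DifferentialRing.
Variables (R : realType) (V : normedModType R) (Om : set V) (I : Type).
Variable dir : I -> V.
Hypothesis Om_open : open Om.

(** Ring elements are functions on [Om] only, whereas directional derivatives act on functions on
    [V]. As [Om] is open, the values outside do not affect derivatives at its points. *)
Definition zero_ext (f : Om -> R) (v : V) : R := oapp f 0 (insub v).

Definition pdiff i (f : Om -> R) : Om -> R :=
  fun p => 'D_(dir i) (zero_ext f) (set_val p).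

Definition pdiffable i (f : Om -> R) :=
  forall p : Om, derivable (zero_ext f) (set_val p) (dir i).

Lemma zero_extE (f : Om -> R) p : zero_ext f (set_val p) = f p.
Proof. by rewrite /zero_ext valK. Qed.

Lemma nbhs_Om (p : Om) : \forall v \near (set_val p), Om v.
Proof. by apply: open_nbhs_nbhs; split=> //; exact: set_valP. Qed.

Lemma pdiff_eq i (f : Om -> R) (F : V -> R) (p : Om) :
  (forall q, f q = F (set_val q)) ->
  derivable F (set_val p) (dir i) ->
  derivable (zero_ext f) (set_val p) (dir i) /\
  pdiff i f p = 'D_(dir i) F (set_val p).
Proof.
move=> fF dF.
have H : {near set_val p, F =1 zero_ext f}.
  near=> v.
  have Ov : Om v by near: v; exact: nbhs_Om.
  by rewrite /zero_ext insubT ?inE // => Ov'; rewrite /= fF.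
split; first exact: near_eq_derivable H dF.
by rewrite /pdiff; apply/esym/near_eq_derive.
Unshelve. all: by end_near. Qed.

Lemma pdiff_cst i c : pdiffable i (cst c) /\ pdiff i (cst c) = cst 0.
Proof.
have H p : derivable (zero_ext (cst c : Om -> R)) (set_val p) (dir i) /\
    pdiff i (cst c) p = 'D_(dir i) (cst c : V -> R) (set_val p).
  by apply: pdiff_eq => // ; exact: derivable_cst.
split=> [p|]; first exact: (H p).1.
by apply/funext => p; rewrite (H p).2 derive_cst.
Qed.

Lemma pdiffD i f h : pdiffable i f -> pdiffable i h ->
  pdiffable i (f + h) /\ pdiff i (f + h) = pdiff i f + pdiff i h.
Proof.
move=> df dh.
have E q : (f + h) q = (zero_ext f + zero_ext h) (set_val q).
  by rewrite !fctE !zero_extE.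
have H p := pdiff_eq E (derivableD (df p) (dh p)).
split=> [p|]; first exact: (H p).1.
by apply/funext => p; rewrite (H p).2 deriveD.
Qed.

Lemma pdiffN i f : pdiffable i f ->
  pdiffable i (- f) /\ pdiff i (- f) = - pdiff i f.
Proof.
move=> df.
have E q : (- f) q = (- zero_ext f) (set_val q) by rewrite !fctE !zero_extE.
have H p := pdiff_eq E (derivableN (df p)).
split=> [p|]; first exact: (H p).1.
by apply/funext => p; rewrite (H p).2 deriveN.
Qed.

Lemma pdiffM i f h : pdiffable i f -> pdiffable i h ->
  pdiffable i (f * h) /\ pdiff i (f * h) = pdiff i f * h + f * pdiff i h.
Proof.
move=> df dh.
have E q : (f * h) q = (zero_ext f * zero_ext h) (set_val q).
  by rewrite !fctE !zero_extE.
have H p := pdiff_eq E (derivableM (df p) (dh p)).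
split=> [p|]; first exact: (H p).1.
apply/funext => p; rewrite (H p).2 deriveM // !zero_extE addrC.
by congr (_ + _); rewrite mulrC.
Qed.

Lemma pdiffV i (f : Om -> R) : (forall p, f p != 0) -> pdiffable i f ->
  pdiffable i (fun p => (f p)^-1) /\
  pdiff i (fun p => (f p)^-1) =
    - ((fun p => (f p)^-1) * (fun p => (f p)^-1)) * pdiff i f.
Proof.
move=> f0 df.
have E q : (f q)^-1 = (fun v => (zero_ext f v)^-1) (set_val q).
  by rewrite zero_extE.
have f0' (p : Om) : zero_ext f (set_val p) != 0 by rewrite zero_extE.
have H p := pdiff_eq E (derivableV (f0' p) (df p)).
split=> [p|]; first exact: (H p).1.
apply/funext => p; rewrite (H p).2 deriveV // !zero_extE.
by rewrite !fctE -exprVn expr2.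
Qed.

(* Everything that is needed about partial derivatives, commutation included,
   only has to be checked on the generating family [base]. *)
Variable base : set (Om -> R).

(** Closure under inverses of nowhere zero functions is what puts the inverse metric into the
    ring. *)
Inductive smooth_gen : (Om -> R) -> Prop :=
| gen_base f : base f -> smooth_gen f
| gen_cst c : smooth_gen (cst c)
| gen_add f h : smooth_gen f -> smooth_gen h -> smooth_gen (f + h)
| gen_opp f : smooth_gen f -> smooth_gen (- f)
| gen_mul f h : smooth_gen f -> smooth_gen h -> smooth_gen (f * h)
| gen_inv f : (forall p, f p != 0) -> smooth_gen f ->
    smooth_gen (fun p => (f p)^-1).

Definition smooth_gen_pred : {pred Om -> R} := [pred f | `[< smooth_gen f >]].

Lemma smooth_gen_subring : subring_closed smooth_gen_pred.
Proof.
split.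
- by apply/asboolP; exact: (gen_cst 1).
- move=> f h /asboolP sf /asboolP sh; apply/asboolP.
  by apply: gen_add => //; apply: gen_opp.
- by move=> f h /asboolP sf /asboolP sh; apply/asboolP/gen_mul.
Qed.

HB.instance Definition _ :=
  GRing.isSubringClosed.Build (Om -> R) smooth_gen_pred smooth_gen_subring.

Record smooth_ring := SmoothRing {
  smooth_val :> Om -> R; _ : smooth_val \in smooth_gen_pred }.
HB.instance Definition _ := [isSub for smooth_val].
HB.instance Definition _ := [Choice of smooth_ring by <:].
HB.instance Definition _ :=
  GRing.SubChoice_isSubComPzRing.Build _ _ smooth_ring (subringClosedP _).

Lemma smooth_genP (f : smooth_ring) : smooth_gen f.
Proof. by case: f => f /= /asboolP. Qed.

Hypothesis baseP : forall f, base f -> forall i,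
  [/\ pdiffable i f, base (pdiff i f)
    & forall j, pdiff i (pdiff j f) = pdiff j (pdiff i f)].

Lemma smooth_gen_pdiff f i :
  smooth_gen f -> pdiffable i f /\ smooth_gen (pdiff i f).
Proof.
elim=> {f} [f bf|c|f h sf [df Df] sh [dh Dh]|f sf [df Df]|
            f h sf [df Df] sh [dh Dh]|f f0 sf [df Df]].
- by have [] := baseP bf i; split=> //; exact: gen_base.
- by have [? ->] := pdiff_cst i c; split=> //; exact: gen_cst.
- by have [? ->] := pdiffD df dh; split=> //; exact: gen_add.
- by have [? ->] := pdiffN df; split=> //; exact: gen_opp.
- by have [? ->] := pdiffM df dh; split=> //; apply: gen_add; exact: gen_mul.
- have [? ->] := pdiffV f0 df; split=> //.
  by apply: gen_mul => //; apply: gen_opp; apply: gen_mul; exact: gen_inv.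
Qed.

(** By induction: the product and inverse rules express mixed second derivatives symmetrically in
    the two directions once those of the arguments commute. *)
Lemma smooth_gen_pdiffC f i j :
  smooth_gen f -> pdiff i (pdiff j f) = pdiff j (pdiff i f).
Proof.
have D := smooth_gen_pdiff.
have dD h a : smooth_gen h -> pdiffable a h by move=> /(D h a) [].
have sD h a : smooth_gen h -> smooth_gen (pdiff a h) by move=> /(D h a) [].
have ddD h a b : smooth_gen h -> pdiffable a (pdiff b h).
  by move=> sh; apply/dD/sD.
elim=> {f} [f bf|c|f h sf IHf sh IHh|f sf IHf|f h sf IHf sh IHh|f f0 sf IHf].
- by have [] := baseP bf i.
- by rewrite !(pdiff_cst _ _).2.
- rewrite (pdiffD (dD _ j sf) (dD _ j sh)).2 (pdiffD (dD _ i sf) (dD _ i sh)).2.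
  rewrite (pdiffD (ddD _ i j sf) (ddD _ i j sh)).2.
  by rewrite (pdiffD (ddD _ j i sf) (ddD _ j i sh)).2 IHf IHh.
- rewrite (pdiffN (dD _ j sf)).2 (pdiffN (dD _ i sf)).2.
  by rewrite (pdiffN (ddD _ i j sf)).2 (pdiffN (ddD _ j i sf)).2 IHf.
- rewrite (pdiffM (dD _ j sf) (dD _ j sh)).2 (pdiffM (dD _ i sf) (dD _ i sh)).2.
  have E a b : pdiff b (pdiff a f * h + f * pdiff a h) =
      pdiff b (pdiff a f) * h + pdiff a f * pdiff b h
      + (pdiff b f * pdiff a h + f * pdiff b (pdiff a h)).
    have s1 : smooth_gen (pdiff a f * h) by exact: gen_mul (sD _ a sf) sh.
    have s2 : smooth_gen (f * pdiff a h) by exact: gen_mul sf (sD _ a sh).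
    rewrite (pdiffD (dD _ b s1) (dD _ b s2)).2.
    rewrite (pdiffM (ddD _ b a sf) (dD _ b sh)).2.
    by rewrite (pdiffM (dD _ b sf) (ddD _ b a sh)).2.
  by rewrite (E i j) (E j i) IHf IHh addrACA.
- pose f' p := (f p)^-1.
  have sf' : smooth_gen f' by exact: gen_inv.
  rewrite (pdiffV f0 (dD _ j sf)).2 (pdiffV f0 (dD _ i sf)).2 -/f'.
  have E a b : pdiff b (- (f' * f') * pdiff a f) =
      2 * (f' * f') * f' * pdiff b f * pdiff a f
      - (f' * f') * pdiff b (pdiff a f).
    have sff : smooth_gen (f' * f') := gen_mul sf' sf'.
    rewrite (pdiffM (dD _ b (gen_opp sff)) (ddD _ b a sf)).2.
    rewrite (pdiffN (dD _ b sff)).2 (pdiffM (dD _ b sf') (dD _ b sf')).2.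
    by rewrite (pdiffV f0 (dD _ b sf)).2 -/f'; ring.
  by rewrite !E IHf; ring.
Qed.

Definition smooth_d i (f : smooth_ring) : smooth_ring :=
  @SmoothRing (pdiff i f) (introT (asboolP _)
    (proj2 (smooth_gen_pdiff i (smooth_genP f)))).

Lemma smooth_d_additive i : zmod_morphism (smooth_d i).
Proof.
move=> f h; apply/val_inj => /=.
have df := (smooth_gen_pdiff i (smooth_genP f)).1.
have dh := (smooth_gen_pdiff i (smooth_genP h)).1.
have [dNh ENh] := pdiffN dh.
by rewrite (pdiffD df dNh).2 ENh.
Qed.

HB.instance Definition _ i :=
  GRing.isZmodMorphism.Build smooth_ring smooth_ring (smooth_d i)
    (smooth_d_additive i).

Lemma smooth_dM i x y :
  smooth_d i (x * y) = smooth_d i x * y + x * smooth_d i y.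
Proof.
apply/val_inj => /=.
have df := (smooth_gen_pdiff i (smooth_genP x)).1.
have dh := (smooth_gen_pdiff i (smooth_genP y)).1.
by rewrite (pdiffM df dh).2.
Qed.

Lemma smooth_dC i j x : smooth_d i (smooth_d j x) = smooth_d j (smooth_d i x).
Proof.
by apply/val_inj => /=; apply: smooth_gen_pdiffC; exact: smooth_genP.
Qed.

(** Evaluation at a point is a ring morphism and turns identities of the ring into numerical
    ones. *)
Definition smooth_eval (p : Om) (f : smooth_ring) : R := f p.

Lemma smooth_eval_additive p : zmod_morphism (smooth_eval p).
Proof. by []. Qed.
Lemma smooth_eval_multiplicative p : monoid_morphism (smooth_eval p).
Proof. by []. Qed.
HB.instance Definition _ p :=
  GRing.isZmodMorphism.Build smooth_ring R (smooth_eval p)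
    (smooth_eval_additive p).
HB.instance Definition _ p :=
  GRing.isMonoidMorphism.Build smooth_ring R (smooth_eval p)
    (smooth_eval_multiplicative p).

End DifferentialRing.

(** * Symmetry of mixed directional derivatives *)

Section MixedDerivatives.
Variables (R : realType) (V : normedModType R).
Implicit Types (F : V -> R) (x u v : V).

Lemma is_derive_line F x u (s df : R) :
  is_derive (x + s *: u) u F df -> is_derive s 1 (fun r => F (x + r *: u)) df.
Proof.
have E : (fun h : R => h^-1 *: (((fun r => F (x + r *: u)) \o shift s) (h *: 1)
      - F (x + s *: u))) =
    (fun h => h^-1 *: ((F \o shift (x + s *: u)) (h *: u) - F (x + s *: u))).
  apply/funext => h /=; congr (_ *: (F _ - _)).
  by rewrite scalerDl [h *: 1]mulr1 addrCA addrA.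
by case=> dF <-; split; rewrite /derivable /derive E.
Qed.

Lemma derive_mean_value F x u (h : R) : 0 < h ->
  (forall s, 0 <= s <= h -> derivable F (x + s *: u) u) ->
  exists2 s, 0 <= s <= h & F (x + h *: u) - F x = h * 'D_u F (x + s *: u).
Proof.
move=> h0 dF.
have dl s : 0 <= s <= h ->
    is_derive s 1 (fun r => F (x + r *: u)) ('D_u F (x + s *: u)).
  by move=> /dF dFs; apply: is_derive_line; exact: derivableP.
have [||s sh] := @MVT R (fun r => F (x + r *: u))
  (fun r => 'D_u F (x + r *: u)) 0 h h0.
- move=> s; rewrite in_itv /= => /andP[s0 sh].
  by apply: dl; rewrite !ltW.
- apply: derivable_within_continuous => s; rewrite in_itv /= => /dl.
  by case.
rewrite subr0 scale0r addr0 mulrC => ->; exists s => //.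
by move: sh; rewrite in_itv /= => /andP[s0 sh]; rewrite !ltW.
Qed.

(** The mean value theorem is applied along u to y -> F(y + h v) - F(y), then along v to D_u F. *)
Lemma second_difference F x u v (h : R) : 0 < h ->
  (forall s t, 0 <= s <= h -> 0 <= t <= h ->
     derivable F (x + s *: u + t *: v) u /\
     derivable ('D_u F) (x + s *: u + t *: v) v) ->
  exists s t, [/\ 0 <= s <= h, 0 <= t <= h &
    F (x + h *: u + h *: v) - F (x + h *: u) - (F (x + h *: v) - F x)
    = h * (h * 'D_v ('D_u F) (x + s *: u + t *: v))].
Proof.
move=> h0 dF.
have hh : 0 <= h <= h by rewrite lexx ltW.
have z0 : 0 <= (0 : R) <= h by rewrite lexx ltW.
pose Q y := F (y + h *: v) - F y.
have isQ s : 0 <= s <= h -> is_derive (x + s *: u) u Q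
    ('D_u F (x + s *: u + h *: v) - 'D_u F (x + s *: u)).
  move=> sh; apply: is_deriveB; last first.
    apply: derivableP; have [] := dF s 0 sh z0.
    by rewrite scale0r addr0.
  have [+ _] := dF s h sh hh.
  have E : (fun k : R => k^-1 *: ((F \o shift (x + s *: u + h *: v)) (k *: u)
      - F (x + s *: u + h *: v))) =
    (fun k => k^-1 *: (((fun y => F (y + h *: v)) \o shift (x + s *: u))
      (k *: u) - F (x + s *: u + h *: v))).
    by apply/funext => k /=; rewrite !addrA.
  by move=> dFs; split; [move: dFs|]; rewrite /derivable /derive E.
have [|s sh Es] := @derive_mean_value Q x u h h0; first by move=> s /isQ [].
have [|t th Et] := @derive_mean_value ('D_u F) (x + s *: u) v h h0.
  by move=> t th; have [] := dF s t sh th.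
exists s, t; split=> //.
move: Es; have [_ ->] := isQ s sh; rewrite Et => <-.
by rewrite /Q.
Qed.

(** Schwarz's theorem: the second difference is symmetric in u and v, and equals h^2 times either
    mixed derivative at a point close to x; continuity concludes. *)
Lemma derive_swap F x u v :
  (\forall y \near x, derivable F y u /\ derivable F y v /\
     derivable ('D_u F) y v /\ derivable ('D_v F) y u) ->
  {for x, continuous ('D_v ('D_u F))} -> {for x, continuous ('D_u ('D_v F))} ->
  'D_v ('D_u F) x = 'D_u ('D_v F) x.
Proof.
move=> dF c1 c2; apply/eqP; rewrite -subr_eq0 -normr_le0.
apply/ler_addgt0Pr => e e0; rewrite add0r.
have e2 : 0 < e / 2 by rewrite divr_gt0.
have H1 : \forall y \near x, `|'D_v ('D_u F) x - 'D_v ('D_u F) y| < e / 2.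
  by move/cvgrPdist_lt: c1; apply.
have H2 : \forall y \near x, `|'D_u ('D_v F) x - 'D_u ('D_v F) y| < e / 2.
  by move/cvgrPdist_lt: c2; apply.
have : \forall y \near x,
  (derivable F y u /\ derivable F y v /\
     derivable ('D_u F) y v /\ derivable ('D_v F) y u) /\
  (`|'D_v ('D_u F) x - 'D_v ('D_u F) y| < e / 2 /\
   `|'D_u ('D_v F) x - 'D_u ('D_v F) y| < e / 2).
  exact: filterI dF (filterI H1 H2).
move=> /nbhs_ballP[r /= r0 Hr].
(* Keeps the parallelogram spanned by h u and h v inside the ball; the added 1 covers u = v = 0. *)
pose h := r / 2 / (`|u| + `|v| + 1).
have n0 : 0 < `|u| + `|v| + 1 by rewrite ltr_wpDl // addr_ge0.
have h0 : 0 < h by rewrite !divr_gt0.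
have Hst s t : 0 <= s <= h -> 0 <= t <= h -> ball x r (x + s *: u + t *: v).
  move=> /andP[s0 sh] /andP[t0 th]; rewrite -ball_normE /=.
  rewrite -addrA opprD addNKr normrN.
  have h1 : `|s *: u + t *: v| <= h * (`|u| + `|v|).
    apply: le_trans (ler_normD _ _) _; rewrite !normrZ !ger0_norm // mulrDr.
    by apply: lerD; rewrite ler_wpM2r.
  apply: le_lt_trans h1 _; apply: le_lt_trans (_ : r / 2 < r); last first.
    by rewrite ltr_pdivrMr // ltr_pMr // ltr1n.
  by rewrite /h mulrAC ler_pdivrMr // ler_wpM2l ?divr_ge0 ?ltW // ltrDl.
have [|s [t [sh th E1]]] := @second_difference F x u v h h0.
  by move=> s t sh th; have [[? [_ [? _]]] _] := Hr _ (Hst s t sh th).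
have Hts a b : 0 <= a <= h -> 0 <= b <= h -> ball x r (x + a *: v + b *: u).
  by move=> sh' th'; rewrite addrAC; exact: Hst.
have [|s' [t' [sh' th' E2]]] := @second_difference F x v u h h0.
  by move=> s1 t1 sh1 th1; have [[_ [? [_ ?]]] _] := Hr _ (Hts s1 t1 sh1 th1).
have [_ [b1 _]] := Hr _ (Hst s t sh th).
have [_ [_ b2]] := Hr _ (Hts s' t' sh' th').
have E : 'D_v ('D_u F) (x + s *: u + t *: v) =
         'D_u ('D_v F) (x + s' *: v + t' *: u).
  apply: (mulfI (lt0r_neq0 h0)); apply: (mulfI (lt0r_neq0 h0)).
  have swap : x + h *: v + h *: u = x + h *: u + h *: v by exact: addrAC.
  apply: etrans (esym E1) (etrans _ E2).
  by rewrite swap !opprD addrACA.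
rewrite -[X in `|X|](subrKA ('D_v ('D_u F) (x + s *: u + t *: v))).
apply: le_trans (ler_normD _ _) _.
rewrite [leRHS]splitr; apply: lerD; first exact: ltW b1.
by rewrite E distrC; exact: ltW b2.
Qed.

End MixedDerivatives.

(** * The jets of a curve of tensor fields in a chart *)

Section SpaceTime.
Variables (R : realType) (n : nat).
Local Notation V := (R * 'rV[R]_n)%type.

Let quotient_time (F : V -> R) (t : R) (x : 'rV[R]_n) :
  (fun h : R => h^-1 *: ((F \o shift (t, x)) (h *: (1, 0)) - F (t, x))) =
  (fun h : R => h^-1 *: (((fun r : R => F (r, x)) \o shift t) (h *: 1)
      - F (t, x))).
Proof.
apply/funext => h /=; congr (_ *: (F _ - _)).
by congr pair; rewrite /= scaler0 add0r.
Qed.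

Let quotient_space (F : V -> R) (t : R) (x w : 'rV[R]_n) :
  (fun h : R => h^-1 *: ((F \o shift (t, x)) (h *: (0, w)) - F (t, x))) =
  (fun h : R => h^-1 *: (((fun y => F (t, y)) \o shift x) (h *: w)
      - F (t, x))).
Proof.
apply/funext => h /=; congr (_ *: (F _ - _)).
by congr pair; rewrite /= scaler0 add0r.
Qed.

Lemma derive_time (F : V -> R) (t : R) (x : 'rV[R]_n) :
  'D_(1, 0) F (t, x) = derive1 (fun r : R => F (r, x)) t.
Proof. by rewrite derive1E /derive quotient_time. Qed.

Lemma derivable_time (F : V -> R) (t : R) (x : 'rV[R]_n) :
  derivable F (t, x) (1, 0) <-> derivable (fun r : R => F (r, x)) t 1.
Proof. by rewrite /derivable quotient_time. Qed.

Lemma derive_space (F : V -> R) (t : R) (x w : 'rV[R]_n) :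
  'D_(0, w) F (t, x) = 'D_w (fun y => F (t, y)) x.
Proof. by rewrite /derive quotient_space. Qed.

Lemma derivable_space (F : V -> R) (t : R) (x w : 'rV[R]_n) :
  derivable F (t, x) (0, w) <-> derivable (fun y => F (t, y)) x w.
Proof. by rewrite /derivable quotient_space. Qed.

Lemma near_eq_pd (U : set 'rV[R]_n) (i : 'I_n) (f h : 'rV[R]_n -> R) x :
  open U -> (forall y, U y -> f y = h y) -> U x -> pd i f x = pd i h x.
Proof.
move=> oU fh Ux; apply: near_eq_derive.
have : \forall y \near x, U y by exact: open_nbhs_nbhs.
by apply: filterS => y /fh.
Qed.

(** Meant for time difference quotients, whose coordinate derivatives are what convergence in S^2(M)
    controls. *)
Lemma pds_scaleB (U : set 'rV[R]_n) (f h : 'rV[R]_n -> R) (c : R) s x :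
  open U -> smooth_on U f -> smooth_on U h -> U x ->
  pds s (fun y => c * (f y - h y)) x = c * (pds s f x - pds s h x).
Proof.
move=> oU sf sh; elim: s x => [//|i s IHs] x Ux.
rewrite [LHS](near_eq_pd i oU IHs Ux).
have df : derivable (pds s f) x (delta_mx 0 i) := (sf s x Ux).2 i.
have dh : derivable (pds s h) x (delta_mx 0 i) := (sh s x Ux).2 i.
have -> : (fun y => c * (pds s f y - pds s h y)) = c *: (pds s f - pds s h).
  by apply/funext.
rewrite /pd deriveZ; last exact: derivableB.
by rewrite deriveB.
Qed.

Lemma pds_swap (U : set 'rV[R]_n) (f : 'rV[R]_n -> R) i j s x :
  open U -> smooth_on U f -> U x ->
  pds [:: i, j & s] f x = pds [:: j, i & s] f x.
Proof.
move=> oU sf Ux.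
have nU : \forall y \near x, U y by exact: open_nbhs_nbhs.
apply: derive_swap.
- apply: filterS nU => y Uy.
  have [_ d0] := sf s y Uy; have [_ d1] := sf (j :: s) y Uy.
  have [_ d2] := sf (i :: s) y Uy.
  by split; [exact: (d0 j)|split; [exact: (d0 i)|split;
     [exact: (d1 i)|exact: (d2 j)]]].
- exact: (sf [:: i, j & s] x Ux).1.
- exact: (sf [:: j, i & s] x Ux).1.
Qed.

End SpaceTime.

Section Jets.
Variables (R : realType) (n : nat) (M : topologicalType).
Variables (A : smooth_atlas R n M) (a : A) (I : set R) (g : R -> components A).
Hypothesis I_open : open I.
Hypothesis g_smooth : smooth_curve I g.
Local Notation V := (R * 'rV[R]_n)%type.
Local Notation U := (cimg (achart a)).

Definition spacetime : set V := [set v | I v.1 /\ U v.2].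

Definition st_dir (o : option 'I_n) : V :=
  if o is Some i then (0, delta_mx 0 i) else (1, 0).

Lemma spacetime_open : open spacetime.
Proof.
have -> : spacetime = (fst @^-1` I) `&` (snd @^-1` U) by [].
apply: openI; apply: open_comp.
- by move=> v _; exact: cvg_fst.
- exact: I_open.
- by move=> v _; exact: cvg_snd.
- exact: cimg_open.
Qed.

(** [k] counts the time derivatives, taken first; [s] lists the coordinate derivatives applied
    afterwards. *)
Definition jet k s i j (v : V) : R :=
  pds s (Defs.coord (iter k (@tderiv R n M A) g v.1) a i j) v.2.

Definition jets : set (spacetime -> R) :=
  [set f | exists k s i j, f = fun p : spacetime => jet k s i j (set_val p)].

(** Convergence in S^2(M) includes coordinate derivatives of the quotients, so the time derivative
    passes under [pds s]. *)
Lemma is_derive_jet_time k s i j t x : I t -> U x ->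
  is_derive (t, x) (1, 0) (jet k s i j) (jet k.+1 s i j (t, x)).
Proof.
move=> It Ux.
suff H : (fun h : R => h^-1 *: (((fun r : R => jet k s i j (r, x)) \o shift t)
    (h *: 1) - jet k s i j (t, x))) @ 0^' --> jet k.+1 s i j (t, x).
  split; first by apply/derivable_time/cvg_ex; exists (jet k.+1 s i j (t, x)).
  by rewrite derive_time derive1E; exact: cvg_lim H.
apply/cvgrPdist_lt => e e0.
(* Convergence at x is enough, so the compact set is a singleton. *)
have [_ /(_ a [set x] (@compact_set1 _ x))] := g_smooth k It.
have sx : [set x] `<=` U by move=> y ->.
move=> /(_ sx s i j e e0) H.
have nI : \forall h \near (0 : R)^', I (t + h).
  apply: cvg_within.
  have : (fun h : R => t + h) @ (0 : R) --> t + 0.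
    by apply: cvgD; [exact: cvg_cst|exact: cvg_id].
  by rewrite addr0; apply; exact: open_nbhs_nbhs.
near=> h.
have Ith : I (t + h) by near: h.
rewrite distrC.
have -> : h^-1 *: (((fun r : R => jet k s i j (r, x)) \o shift t) (h *: 1)
    - jet k s i j (t, x)) =
  pds s (Defs.coord (fun a p => h^-1 *: (iter k (@tderiv R n M A) g (t + h) a p
      - iter k (@tderiv R n M A) g t a p)) a i j) x.
  have -> : Defs.coord (fun a p =>
      h^-1 *: (iter k (@tderiv R n M A) g (t + h) a p
      - iter k (@tderiv R n M A) g t a p)) a i j =
    (fun y => h^-1 * (Defs.coord (iter k (@tderiv R n M A) g (t + h)) a i j y
      - Defs.coord (iter k (@tderiv R n M A) g t) a i j y)).
    by apply/funext => y; rewrite /Defs.coord !mxE.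
  rewrite (@pds_scaleB _ _ U) //.
  - by rewrite /= [h *: 1]mulr1 [h + t]addrC.
  - exact: cimg_open.
  - by have [[_ _]] := g_smooth k Ith.
  - by have [[_ _]] := g_smooth k It.
near: h; apply: filterS H => h /(_ x); exact.
Unshelve. all: by end_near. Qed.

Lemma is_derive_jet_space k s i j l t x : I t -> U x ->
  is_derive (t, x) (0, delta_mx 0 l) (jet k s i j) (jet k (l :: s) i j (t, x)).
Proof.
move=> It Ux; have [[_ _ sm] _] := g_smooth k It.
split; last by rewrite derive_space.
by apply/derivable_space; have [_] := sm a i j s x Ux; apply.
Qed.

Definition jet_step (o : option 'I_n) k s :=
  if o is Some l then (k, l :: s) else (k.+1, s).

Lemma pdiff_jet o k s i j :
  let f := fun p : spacetime => jet k s i j (set_val p) in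
  pdiffable st_dir o f /\
  pdiff st_dir o f = fun p : spacetime =>
    jet (jet_step o k s).1 (jet_step o k s).2 i j (set_val p).
Proof.
move=> f.
have H (p : spacetime) : is_derive (set_val p) (st_dir o) (jet k s i j)
    (jet (jet_step o k s).1 (jet_step o k s).2 i j (set_val p)).
  have : I (set_val p).1 /\ U (set_val p).2 := set_valP p.
  case: (set_val p) => t x [/= It Ux].
  case: o => [l|]; first exact: (is_derive_jet_space k s i j l It Ux).
  exact: (is_derive_jet_time k s i j It Ux).
have E p := @pdiff_eq _ _ _ _ st_dir spacetime_open o f (jet k s i j) p
  (fun=> erefl) (@ex_derive _ _ _ _ _ _ _ (H p)).
split=> [p|]; first exact: (E p).1.
by apply/funext => p; rewrite (E p).2; have [_ ->] := H p.
Qed.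

Lemma jets_closed (f : spacetime -> R) : jets f -> forall o,
  [/\ pdiffable st_dir o f, jets (pdiff st_dir o f)
    & forall o', pdiff st_dir o (pdiff st_dir o' f)
                 = pdiff st_dir o' (pdiff st_dir o f)].
Proof.
move=> [k [s [i [j ->]]]] o; have [df Df] := pdiff_jet o k s i j.
split; first exact: df.
  by rewrite Df; exists (jet_step o k s).1, (jet_step o k s).2, i, j.
move=> o'; rewrite Df (pdiff_jet o' k s i j).2.
rewrite [LHS](pdiff_jet _ _ _ _ _).2 [RHS](pdiff_jet _ _ _ _ _).2.
clear df Df.
(* If one direction is time, both orders give the same jet by construction; only two coordinates
   require Schwarz's theorem. *)
case: o o' => [l|] [l'|]; [|exact: erefl|exact: erefl|exact: erefl].
apply/funext => p; have : I (set_val p).1 /\ U (set_val p).2 := set_valP p.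
case: (set_val p) => t x [/= It Ux].
have [[_ _ sm] _] := g_smooth k It.
exact: (pds_swap l l' s (@cimg_open _ _ _ (achart a)) (sm a i j) Ux).
Qed.

End Jets.

(** * Coordinate fields as elements of the jet ring *)

Section Representation.
Variables (R : realType) (n : nat) (M : topologicalType).
Variables (A : smooth_atlas R n M) (a : A) (I : set R) (g : R -> components A).
Hypothesis I_open : open I.
Hypothesis g_smooth : smooth_curve I g.
Local Notation V := (R * 'rV[R]_n)%type.
Local Notation U := (cimg (achart a)).
Local Notation cinv := (cinv (achart a)).
Local Notation cfun := (cfun (achart a)).

Definition jet_ring := smooth_ring (@jets R n M A a I g).
HB.instance Definition _ := GRing.ComPzRing.on jet_ring.

Definition jet_d (o : option 'I_n) : {additive jet_ring -> jet_ring} :=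
  smooth_d (spacetime_open I_open) (jets_closed I_open g_smooth) o.

Lemma jet_dM o x y : jet_d o (x * y) = jet_d o x * y + x * jet_d o y.
Proof. exact: smooth_dM. Qed.

Lemma jet_dC o o' x : jet_d o (jet_d o' x) = jet_d o' (jet_d o x).
Proof. exact: smooth_dC. Qed.

Definition jet_cst (c : R) : jet_ring :=
  @SmoothRing _ _ _ (@jets R n M A a I g) (cst c)
    (introT (asboolP _) (gen_cst _ c)).

Lemma jet_d_cst o c : jet_d o (jet_cst c) = 0.
Proof.
by apply/val_inj; exact: (pdiff_cst _ (spacetime_open I_open) o c).2.
Qed.

Definition jet_elt k s i j : jet_ring :=
  @SmoothRing _ _ _ (@jets R n M A a I g) _
    (introT (asboolP _) (gen_base (ex_intro _ k (ex_intro _ s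
       (ex_intro _ i (ex_intro _ j erefl)))))).

Definition jet_inv (f : jet_ring) (f0 : forall p, f p != 0) : jet_ring :=
  @SmoothRing _ _ _ (@jets R n M A a I g) _
    (introT (asboolP _) (gen_inv f0 (smooth_genP f))).

Definition ev (p : spacetime a I) : {rmorphism jet_ring -> R} := smooth_eval p.

Lemma jet_ring_ext (f h : jet_ring) : (forall p, ev p f = ev p h) -> f = h.
Proof. by move=> fh; apply/val_inj/funext => p; exact: fh. Qed.

(** [f] depends on time and coordinates, [F] on time and points of M; they are compared only over I
    and the chart. *)
Definition rep (f : jet_ring) (F : R -> M -> R) :=
  forall p : spacetime a I, ev p f = F (set_val p).1 (cinv (set_val p).2).

Lemma cinvK x : U x -> cfun (cinv x) = x.
Proof. by case=> q dq <-; rewrite cfunK. Qed.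

Lemma rep_near f F (p : spacetime a I) : rep f F ->
  \forall v \near set_val p, zero_ext f v = F v.1 (cinv v.2).
Proof.
move=> fF; have := nbhs_Om (spacetime_open I_open) p.
apply: filterS => v vO.
by rewrite /zero_ext insubT ?inE // => vO' /=; exact: (fF (SigSub vO')).
Qed.

Lemma rep_dx f F i : rep f F ->
  rep (jet_d (Some i) f) (fun t q => cpd (achart a) i (F t) q).
Proof.
move=> fF p; have E := near_eq_derive (0, delta_mx 0 i) (rep_near p fF).
transitivity ('D_(0, delta_mx 0 i) (fun v : V => F v.1 (cinv v.2)) (set_val p)).
  exact: E.
have : I (set_val p).1 /\ U (set_val p).2 := set_valP p.
case: (set_val p) => t x [/= It Ux].
by rewrite derive_space /cpd cinvK.
Qed.

Lemma rep_dt f F : rep f F ->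
  rep (jet_d None f) (fun t q => derive1 (fun s => F s q) t).
Proof.
move=> fF p; have E := near_eq_derive ((1, 0) : V) (rep_near p fF).
transitivity ('D_(1, 0) (fun v : V => F v.1 (cinv v.2)) (set_val p)).
  exact: E.
by case: (set_val p) => t x; rewrite derive_time.
Qed.

Lemma is_derive_rep f F t x : rep f F -> I t -> U x ->
  is_derive t 1 (fun s => F s (cinv x)) (derive1 (fun s => F s (cinv x)) t).
Proof.
move=> fF It Ux.
have tx : (t, x) \in spacetime a I by rewrite inE; split.
have df : pdiffable (@st_dir R n) None f := (smooth_gen_pdiff
  (spacetime_open I_open) (jets_closed I_open g_smooth) None (smooth_genP f)).1.
have := near_eq_derivable (rep_near (SigSub tx) fF) (df (SigSub tx)).
by move=> /derivable_time; rewrite derive1E => /derivableP.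
Qed.

End Representation.

(** * The fields of a solution in a chart *)

Section SolutionFields.
Variables (R : realType) (n : nat) (M : topologicalType).
Variables (A : smooth_atlas R n M) (a : A) (I : set R) (g : R -> components A).
Variables (alpha lambda : R).
Hypothesis n_ge2 : (2 <= n)%N.
Hypothesis I_open : open I.
Hypothesis g_sol : solution alpha lambda I g.
Local Notation U := (cimg (achart a)).
Local Notation cinv := (cinv (achart a)).
Local Notation cfun := (cfun (achart a)).
Local Notation B := (@jet_ring R n M A a I g).

Let g_smooth : smooth_curve I g.
Proof. by case: g_sol. Qed.

Local Notation d := (@jet_d R n M A a I g I_open g_smooth).
Local Notation tm p := ((set_val p).1).
Local Notation pt p := (cinv (set_val p).2).

Lemma spacetimeP (p : spacetime a I) : I (tm p) /\ cdom (achart a) (pt p).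
Proof.
have : I (set_val p).1 /\ U (set_val p).2 := set_valP p.
by case=> It [q dq <-]; rewrite cfunK.
Qed.

Definition gB : 'M[B]_n := \matrix_(i, j) jet_elt a I g 0 [::] i j.

Lemma ev_gB (p : spacetime a I) : map_mx (ev g p) gB = g (tm p) a (pt p).
Proof. by apply/matrixP => i j; rewrite !mxE. Qed.

(** A nonzero kernel vector would contradict positivity. *)
Lemma metric_unitmx t q : I t -> cdom (achart a) q -> g t a q \in unitmx.
Proof.
move=> It dq; have [_ /(_ t It) [_ pos] _] := g_sol.
rewrite unitmxE unitfE; apply/det0P => -[v v0 vg0].
by have := pos a q v dq v0; rewrite vg0 mul0mx mxE ltxx.
Qed.

Lemma det_gB_neq0 (p : spacetime a I) : (\det gB : B) p != 0.
Proof.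
have [It dq] := spacetimeP p; have := metric_unitmx It dq.
by rewrite unitmxE unitfE -ev_gB det_map_mx.
Qed.

(** Cramer's formula, available since the determinant is nowhere zero on the chart. *)
Definition GB : 'M[B]_n := jet_inv det_gB_neq0 *: \adj gB.

Lemma gB_GB : gB *m GB = 1%:M.
Proof.
rewrite /GB -scalemxAr mul_mx_adj scale_scalar_mx; congr (_%:M).
apply: jet_ring_ext => p.
by rewrite rmorphM rmorph1 /= mulVf //; exact: det_gB_neq0.
Qed.

Lemma GB_gB : GB *m gB = 1%:M.
Proof.
by rewrite /GB -scalemxAl mul_adj_mx -[RHS]gB_GB /GB -scalemxAr mul_mx_adj.
Qed.

Lemma ev_GB (p : spacetime a I) :
  map_mx (ev g p) GB = invmx (g (tm p) a (pt p)).
Proof.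
have [It dq] := spacetimeP p; have gu := metric_unitmx It dq.
have := congr1 (map_mx (ev g p)) gB_GB; rewrite map_mxM map_mx1 ev_gB => gG.
by rewrite -[LHS]mul1mx -(mulVmx gu) -mulmxA gG mulmx1.
Qed.

Lemma gB_sym : gB^T = gB.
Proof.
apply/matrixP => i j; apply: jet_ring_ext => p.
have [It dq] := spacetimeP p; have [[sym _ _] _] := g_smooth 0 It.
have := congr1 (fun X : 'M[R]_n => X i j) (sym a _ dq).
by rewrite !mxE.
Qed.

Definition halfB : B := jet_cst a I g 2^-1.

Lemma halfB2 : halfB + halfB = 1.
Proof.
apply: jet_ring_ext => p; rewrite rmorphD rmorph1.
by rewrite [RHS]splitr !mul1r.
Qed.

Definition GamB := levi_civita d halfB gB GB.
Definition kB := dt d gB.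
Definition KB := GB *m kB.

Lemma rep_g i j : rep (gB i j) (fun t q => g t a q i j).
Proof. by move=> p; rewrite mxE. Qed.

Lemma rep_christoffel k i j :
  rep (GamB i k j) (fun t q => christoffel (g t) a k i j q).
Proof.
move=> p; rewrite /GamB /christoffel mxE rmorph_sum mulr_sumr.
apply: eq_bigr => l _; rewrite rmorphM [(\matrix_(_, _) _) l j]mxE rmorphM.
apply: etrans (mulrCA _ _ _) _; congr (_ * (_ * _)).
  by rewrite -(ev_GB p) [RHS]mxE.
apply: etrans (rmorphB _ _ _) _; rewrite rmorphD; congr (_ + _ - _).
- exact: (rep_dx I_open g_smooth i (rep_g j l) p).
- exact: (rep_dx I_open g_smooth j (rep_g i l) p).
- exact: (rep_dx I_open g_smooth l (rep_g i j) p).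
Qed.

Lemma ev_mulmx (p : spacetime a I) (X Y : 'M[B]_n) i j :
  ev g p ((X *m Y) i j) = \sum_l ev g p (X i l) * ev g p (Y l j).
Proof.
by rewrite mxE rmorph_sum; apply: eq_bigr => m _; rewrite rmorphM.
Qed.

Lemma rep_riemann l k i j :
  rep (curv d GamB i j l k) (fun t q => riemann (g t) a l k i j q).
Proof.
move=> p; rewrite /curv /riemann !(addmxE, oppmxE) rmorphD !rmorphB.
congr (_ - _ + _).
- by rewrite mxE; exact: (rep_dx I_open g_smooth i (rep_christoffel l j k) p).
- by rewrite mxE; exact: (rep_dx I_open g_smooth j (rep_christoffel l i k) p).
apply: etrans
  (congr2 (fun u v => u - v) (ev_mulmx _ _ _ _ _) (ev_mulmx _ _ _ _ _)) _.
rewrite -sumrB; apply: eq_bigr => m _.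
by rewrite -(rep_christoffel l i m p) -(rep_christoffel m j k p)
  -(rep_christoffel l j m p) -(rep_christoffel m i k p).
Qed.

Lemma ev_ric (p : spacetime a I) :
  map_mx (ev g p) (ric d GamB) = ricci (g (tm p)) a (pt p).
Proof.
apply/matrixP => j k; rewrite [LHS]mxE [RHS]mxE [ric _ _ _ _]mxE rmorph_sum.
by apply: eq_bigr => i _; rewrite -(rep_riemann i k i j p).
Qed.

Lemma rep_scal : rep (scalar_curv d GB GamB) (fun t q => scal (g t) a q).
Proof.
move=> p; rewrite /scal /trg /scalar_curv /ricsharp -ev_ric -ev_GB -map_mxM.
by rewrite trace_map_mx.
Qed.

Lemma ev_kB (p : spacetime a I) :
  map_mx (ev g p) kB = tderiv g (tm p) a (pt p).
Proof.
apply/matrixP => i j; rewrite [LHS]mxE [RHS]mxE [kB i j]mxE.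
exact: (rep_dt I_open g_smooth (rep_g i j) p).
Qed.

Lemma rep_trK :
  rep (\tr KB) (fun t q => trg (g t a q) (tderiv g t a q)).
Proof.
by move=> p; rewrite /trg -ev_GB -ev_kB -map_mxM trace_map_mx.
Qed.

Lemma rep_ipm : rep (inner_velocity d gB GB)
  (fun t q => ipm (g t a q) (tderiv g t a q) (tderiv g t a q)).
Proof.
move=> p; rewrite /ipm -!(rep_trK p) -ev_GB -ev_kB -!map_mxM trace_map_mx.
by rewrite /inner_velocity rmorphB rmorphM mulmxA.
Qed.

Lemma rep_det : rep (\det gB) (fun t q => \det (g t a q)).
Proof. by move=> p; rewrite -ev_gB det_map_mx. Qed.

Lemma rep_nabla i k j :
  rep ((dx d i kB - (GamB i)^T *m kB - kB *m GamB i) k j)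
      (fun t q => nabla (g t) (tderiv g t) a i k j q).
Proof.
move=> p.
have subE (X Y Z : 'M[B]_n) : ev g p ((X - Y - Z) k j) =
    ev g p (X k j) - ev g p (Y k j) - ev g p (Z k j).
  by rewrite !(addmxE, oppmxE) !rmorphB.
apply: etrans (subE _ _ _) _; rewrite /nabla.
have kE u v : rep (kB u v) (fun t q => tderiv g t a q u v).
  by move=> p'; rewrite -ev_kB [RHS]mxE.
congr (_ - _ - _).
- by rewrite mxE; exact: (rep_dx I_open g_smooth i (kE k j) p).
- apply: etrans (ev_mulmx _ _ _ _ _) _; apply: eq_bigr => l _.
  by rewrite -(rep_christoffel l i k p) [_^T _ _]mxE -(kE l j p).
- apply: etrans (ev_mulmx _ _ _ _ _) _; apply: eq_bigr => l _.
  by rewrite -(rep_christoffel l i j p) -(kE k l p) mulrC.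
Qed.

(** Here [Gsym] and [Gmet] concern the connection [GamB]: zero torsion and metric compatibility. *)
Let Gsym := levi_civita_sym d halfB GB gB_sym.
Let Gmet := levi_civita_metric d halfB2 gB_sym gB_GB.

Lemma rep_deltam j : rep (div_velocity d gB GB GamB j)
  (fun t q => deltam (g t) (tderiv g t) a j q).
Proof.
move=> p; rewrite (div_velocityE (@jet_dM _ _ _ _ _ _ _ I_open g_smooth)
  gB_GB GB_gB Gmet j) rmorphD rmorphN /deltam /delta; congr (- _ + _).
  rewrite rmorph_sum; apply: eq_bigr => i _.
  apply: etrans (ev_mulmx _ _ _ _ _) _; apply: eq_bigr => k _.
  by rewrite (rep_nabla i k j p) -ev_GB [map_mx _ _ _ _]mxE.
exact: (rep_dx I_open g_smooth j rep_trK p).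
Qed.

Let cB : B := jet_cst a I g (n%:R - 1)^-1.
Let alB : B := jet_cst a I g alpha.
Let laB : B := jet_cst a I g lambda.

(** The hypothesis n >= 2 enters here. *)
Let n1_neq0 : n%:R - 1 != 0 :> R.
Proof. by rewrite subr_eq0 -[1]/(1%:R) eqr_nat gtn_eqF. Qed.

Let nc : (n%:R - 1) * cB = 1.
Proof.
apply: jet_ring_ext => p; rewrite rmorphM rmorphB rmorph_nat rmorph1.
exact: mulfV.
Qed.

Lemma jet_mx_ext (X Y : 'M[B]_n) :
  (forall p : spacetime a I, map_mx (ev g p) X = map_mx (ev g p) Y) -> X = Y.
Proof.
move=> XY; apply/matrixP => i j; apply: jet_ring_ext => p.
have := congr1 (fun Z : 'M[R]_n => Z i j) (XY p).
by rewrite [LHS]mxE [RHS]mxE.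
Qed.

Lemma evolution_kB : dt d kB = kB *m GB *m kB - (halfB * \tr KB) *: kB
  - (halfB * halfB * cB * inner_velocity d gB GB) *: gB
  - (2 * alB) *: (- ric d GamB + (halfB * cB * scalar_curv d GB GamB) *: gB
                  + (laB * halfB) *: gB).
Proof.
apply: jet_mx_ext => p; have [It dq] := spacetimeP p.
have [_ _ /(_ _ It a _ dq) evol] := g_sol.
transitivity (tderiv (tderiv g) (tm p) a (pt p)).
  apply/matrixP => i j; rewrite [LHS]mxE [RHS]mxE [dt d kB i j]mxE.
  have kE : rep (kB i j) (fun t q => tderiv g t a q i j).
    by move=> p'; rewrite -ev_kB [RHS]mxE.
  exact: (rep_dt I_open g_smooth kE p).
rewrite evol /Gammam /gradS 3!map_mxB 2!map_mxM ev_GB.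
rewrite !map_mxZ 2!map_mxD map_mxN !map_mxZ ev_kB ev_gB ev_ric.
(* Both sides now involve the same matrices; only the five scalar coefficients remain to be
   compared. *)
have scalars (X Y Z W : 'M[R]_n) s1 s2 s3 s4 s5 r1 r2 r3 r4 r5 :
    r1 = s1 -> r2 = s2 -> r3 = s3 -> r4 = s4 -> r5 = s5 ->
    X - s1 *: Y - s2 *: Z - s3 *: (- W + s4 *: Z + s5 *: Z) =
    X - r1 *: Y - r2 *: Z - r3 *: (- W + r4 *: Z + r5 *: Z).
  by do 5!move=> ->.
apply: scalars.
- by rewrite rmorphM (rep_trK p).
- rewrite 3!rmorphM (rep_ipm p); congr (_ * _).
  transitivity (2^-1 * 2^-1 * (n%:R - 1)^-1 : R); first by [].
  by field; rewrite n1_neq0.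
- by rewrite rmorphM rmorph_nat.
- rewrite 2!rmorphM (rep_scal p); congr (_ * _).
  transitivity (2^-1 * (n%:R - 1)^-1 : R); first by [].
  by rewrite invfM.
- by rewrite rmorphM.
Qed.

Lemma rep_Hlambda : rep (hamiltonian d halfB gB GB GamB alB laB)
  (fun t q => Hlambda alpha lambda (g t) (tderiv g t) a q).
Proof.
move=> p; rewrite /hamiltonian /Hlambda /scal_lambda rmorphD 3!rmorphM.
by rewrite (rep_ipm p) rmorphB (rep_scal p) rmorphM rmorphB !rmorph_nat rmorph1.
Qed.

Let rep_is_derive (f h : B) (F H : R -> M -> R) t q :
  rep f F -> rep h H -> d None f = h -> I t -> cdom (achart a) q ->
  is_derive t 1 (fun s => F s q) (H t q).
Proof.
move=> fF hH fh It dq.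
have Uq : U (cfun q) by exists q.
have := is_derive_rep I_open g_smooth fF It Uq; rewrite cfunK // => dF.
have tq : (t, cfun q) \in spacetime a I by rewrite inE; split.
have := hH (SigSub tq); rewrite -fh (rep_dt I_open g_smooth fF (SigSub tq)) /=.
by rewrite cfunK // => <-.
Qed.

(** Evaluates the ring identity f' = -(tr K / 2) f as a linear equation in t at a fixed point. *)
Let rep_logderiv (f : B) (F : R -> M -> R) t q :
  rep f F -> d None f = - (halfB * \tr KB) * f -> I t -> cdom (achart a) q ->
  is_derive t 1 (fun s => F s q)
    (- 2^-1 * trg (g t a q) (tderiv g t a q) * F t q).
Proof.
move=> fF df It dq; apply: (rep_is_derive
  (H := fun t q => - 2^-1 * trg (g t a q) (tderiv g t a q) * F t q)
  fF _ df It dq).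
by move=> p; rewrite rmorphM rmorphN rmorphM (rep_trK p) (fF p) !mulNr.
Qed.

Lemma is_derive_deltam j t q : I t -> cdom (achart a) q ->
  is_derive t 1 (fun s => deltam (g s) (tderiv g s) a j q)
    (- 2^-1 * trg (g t a q) (tderiv g t a q)
      * deltam (g t) (tderiv g t) a j q).
Proof.
apply: rep_logderiv (rep_deltam j) _.
exact: (dt_div_velocity_evol (@jet_dM _ _ _ _ _ _ _ I_open g_smooth)
  (@jet_dC _ _ _ _ _ _ _ I_open g_smooth) halfB2 gB_sym gB_GB GB_gB Gsym Gmet
  nc (fun o => jet_d_cst a I_open g_smooth o alpha)
  (fun o => jet_d_cst a I_open g_smooth o lambda) evolution_kB j).
Qed.

Lemma is_derive_Hlambda t q :
  (forall t, I t -> momentum_constraint (g t) (tderiv g t)) ->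
  I t -> cdom (achart a) q ->
  is_derive t 1 (fun s => Hlambda alpha lambda (g s) (tderiv g s) a q)
    (- 2^-1 * trg (g t a q) (tderiv g t a q)
      * Hlambda alpha lambda (g t) (tderiv g t) a q).
Proof.
move=> constr; apply: rep_logderiv rep_Hlambda _.
apply: (dt_hamiltonian (@jet_dM _ _ _ _ _ _ _ I_open g_smooth)
  (@jet_dC _ _ _ _ _ _ _ I_open g_smooth) halfB2 gB_sym gB_GB GB_gB Gsym Gmet
  nc (fun o => jet_d_cst a I_open g_smooth o alpha)
  (fun o => jet_d_cst a I_open g_smooth o lambda) evolution_kB).
(* The constraint holds at all times and points of the chart, hence as an identity in the ring. *)
move=> j; apply: jet_ring_ext => p; have [It dq] := spacetimeP p.
by rewrite (rep_deltam j p) constr // rmorph0.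
Qed.

Lemma is_derive_det t q : I t -> cdom (achart a) q ->
  is_derive t 1 (fun s => \det (g s a q))
    (trg (g t a q) (tderiv g t a q) * \det (g t a q)).
Proof.
apply: (rep_is_derive
  (H := fun t q => trg (g t a q) (tderiv g t a q) * \det (g t a q))
  rep_det _ (dt_det (@jet_dM _ _ _ _ _ _ _ I_open g_smooth) gB_GB)).
by move=> p; rewrite rmorphM (rep_trK p) (rep_det p).
Qed.

Lemma derivable_trg t q : I t -> cdom (achart a) q ->
  derivable (fun s => trg (g s a q) (tderiv g s a q)) t 1.
Proof.
move=> It dq; have Uq : U (cfun q) by exists q.
by have [] := is_derive_rep I_open g_smooth rep_trK It Uq; rewrite cfunK.
Qed.

End SolutionFields.

(** * Scalar linear differential equations *)

Section LinearOde.
Variables (R : realType) (I : set R).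
Hypothesis I_interval : is_interval I.
Implicit Types (y th L : R -> R).

Lemma is_derive_continuous (f : R -> R) (t df : R) :
  is_derive t 1 f df -> {for t, continuous f}.
Proof.
by case=> d _; exact/differentiable_continuous/derivable1_diffP.
Qed.

Lemma itv_subset (s t : R) : I s -> I t -> `[s, t] `<=` I.
Proof.
move=> Is It r; rewrite /= in_itv /= => /andP[sr rt].
by apply: (I_interval Is It); rewrite sr rt.
Qed.

Lemma within_continuous_itv (f : R -> R) (s t : R) : I s -> I t ->
  (forall r, I r -> {for r, continuous f}) -> {within `[s, t], continuous f}.
Proof.
move=> Is It cf; apply: continuous_in_subspaceT => r; rewrite inE => rst.
by apply: cf; exact: itv_subset rst.
Qed.

Lemma derive0_constant (f : R -> R) (s t : R) :
  (forall r, I r -> is_derive r 1 f 0) -> I s -> I t -> f t = f s.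
Proof.
move=> df; wlog st : s t / s <= t.
  move=> H Is It; have [/H|/ltW /H] := leP s t; first exact.
  by move=> /(_ It Is).
move=> Is It; have [||r _] := @MVT_segment R f (fun=> 0) s t st.
- by move=> r rst; apply/df/(itv_subset Is It)/subset_itv_oo_cc.
- by apply: within_continuous_itv => // r /df /is_derive_continuous.
by rewrite mul0r => /eqP; rewrite subr_eq0 => /eqP.
Qed.

(** Integrating factor: y exp (-c L) has zero derivative, hence is constant on the interval. *)
Lemma linear_ode_exp y th L (c : R) (s t : R) :
  (forall r, I r -> is_derive r 1 y (c * th r * y r)) ->
  (forall r, I r -> is_derive r 1 L (th r)) ->
  I s -> I t -> y t = y s * expR (c * (L t - L s)).
Proof.
move=> dy dL Is It.
pose z r := y r * expR (- (c * L r)).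
have dz r : I r -> is_derive r 1 z 0.
  move=> Ir; have dyr := dy r Ir; have dLr := dL r Ir.
  have dcL : is_derive r 1 (fun r => - (c * L r)) (- (c * th r)).
    exact: (is_deriveN (is_deriveZ c dLr)).
  have dE : is_derive r 1 (fun r => expR (- (c * L r)))
      (- (c * th r) * expR (- (c * L r))).
    have := @is_derive1_comp _ expR _ r _ _ (is_derive_expR _) dcL.
    by rewrite mulrC.
  apply: (@is_derive_eq _ _ _ z r 1 _ _ (is_deriveM dyr dE)).
  by rewrite /GRing.scale /=; ring.
have := derive0_constant dz Is It; rewrite /z => zE.
have -> : y t = y t * expR (- (c * L t)) * expR (c * L t).
  by rewrite -mulrA -expRD addNr expR0 mulr1.
by rewrite zE -mulrA -expRD mulrBr addrC.
Qed.

Lemma oriented_integral_antiderivative th L (s t : R) :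
  (forall r, I r -> {for r, continuous th}) ->
  (forall r, I r -> is_derive r 1 L (th r)) ->
  I s -> I t -> oriented_integral th s t = L t - L s.
Proof.
move=> cth dL.
have H u v : u < v -> I u -> I v ->
    \int[@lebesgue_measure R]_(r in `[u, v]) th r = L v - L u.
  move=> uv Iu Iv; rewrite /Rintegral (@continuous_FTC2 _ th L u v) //.
  - exact: within_continuous_itv.
  - split.
    + move=> r ruv; have [] // := dL r _.
      by apply: (itv_subset Iu Iv); exact: subset_itv_oo_cc.
    + have := is_derive_continuous (dL u Iu); exact: cvg_at_right_filter.
    + have := is_derive_continuous (dL v Iv); exact: cvg_at_left_filter.
  - move=> r ruv; rewrite derive1E; have [|_ -> //] := dL r _.
    by apply: (itv_subset Iu Iv); exact: subset_itv_oo_cc.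
move=> Is It; rewrite /oriented_integral; case: leP => [|ts].
  (* Equal endpoints are treated apart, as [H] assumes u < v. *)
  rewrite le_eqVlt => /predU1P[<-|st]; last exact: H.
  by rewrite set_itv1 Rintegral_set1 subrr.
by rewrite H // opprB.
Qed.

End LinearOde.

(** * Logarithm of the determinant and square root of an exponential *)

Section LogAbs.
Variable R : realType.

(* The square makes the sign of [D] irrelevant. *)
Lemma is_derive_log_abs (D : R -> R) (t th : R) :
  D t != 0 -> is_derive t 1 D (th * D t) ->
  is_derive t 1 (fun s => 2^-1 * ln (D s * D s)) th.
Proof.
move=> D0 dD; have D2 : 0 < D t * D t by rewrite -expr2 exprn_even_gt0.
have dDD := is_deriveM dD dD.
have := @is_derive1_comp _ (@ln R) _ t _ _ (is_derive1_ln D2) dDD.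
move=> dl; apply: (@is_derive_eq _ _ _ _ t 1 _ _ (is_deriveZ 2^-1 dl)).
by rewrite /GRing.scale /=; field.
Qed.

End LogAbs.

Lemma sqrt_expR (R : realType) (x : R) : Num.sqrt (expR x) = expR (2^-1 * x).
Proof.
have -> : expR x = expR (2^-1 * x) ^+ 2.
  by rewrite -expRM_natl mulrA divff // mul1r.
by rewrite sqrtr_sqr gtr0_norm // expR_gt0.
Qed.

(** * Propagation of the constraint and conservation of the density *)

Theorem corollary5p7 (R : realType) (n : nat) (M : topologicalType)
    (A : smooth_atlas R n M) (alpha lambda : R) (I : set R)
    (g : R -> components A)
    (hn : (2 <= n)%N)
    (hM_hausdorff : hausdorff_space M)
    (hM_compact : compact [set: M])
    (hM_connected : connected [set: M])
    (halpha : alpha != 0)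
    (hI_open : open I) (hI_interval : is_interval I)
    (hg : solution alpha lambda I g) :
  ((exists2 t0, I t0 & momentum_constraint (g t0) (tderiv g t0)) ->
    forall t, I t -> momentum_constraint (g t) (tderiv g t)) /\
  ((forall t, I t -> momentum_constraint (g t) (tderiv g t)) ->
    forall (a : A) (p : M), cdom (achart a) p ->
    forall t t0 : R, I t -> I t0 ->
      Hlambda alpha lambda (g t) (tderiv g t) a p * mu (g t) a p
      = Hlambda alpha lambda (g t0) (tderiv g t0) a p * mu (g t0) a p
      /\
      Hlambda alpha lambda (g t) (tderiv g t) a p
      = Hlambda alpha lambda (g t0) (tderiv g t0) a p
        * expR (- 2^-1 * oriented_integral
                  (fun s => trg (g s a p) (tderiv g s a p)) t0 t)).
Proof.
(* This is log |det g|, an antiderivative of tr K. *)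
pose L a p s : R := 2^-1 * ln (\det (g s a p) * \det (g s a p)).
have dL a p : cdom (achart a) p -> forall s, I s ->
    is_derive s 1 (L a p) (trg (g s a p) (tderiv g s a p)).
  move=> dp s Is; apply: (is_derive_log_abs _ (is_derive_det hI_open hg Is dp)).
  by have := metric_unitmx hg Is dp; rewrite unitmxE unitfE.
(* The momentum at t is its value at t0 times an exponential, so it stays zero. *)
split=> [[t0 It0 c0] t It a p dp j | constr a p dp t t0 It It0].
  rewrite (linear_ode_exp hI_interval
    (fun s Is => is_derive_deltam hn hI_open hg j Is dp) (dL a p dp) It0 It).
  by rewrite c0 // mul0r.
have HE := linear_ode_exp hI_interval
  (fun s Is => is_derive_Hlambda hn hI_open hg constr Is dp) (dL a p dp) It0 It.
(* The determinant solves the same kind of equation with c = 1 in place of -1/2. *)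
have detE : \det (g t a p) = \det (g t0 a p) * expR (1 * (L a p t - L a p t0)).
  have dD s : I s -> is_derive s 1 (fun r => \det (g r a p))
      (1 * trg (g s a p) (tderiv g s a p) * \det (g s a p)).
    move=> Is; have := is_derive_det hI_open hg Is dp.
    by rewrite mul1r.
  exact: (linear_ode_exp hI_interval dD (dL a p dp) It0 It).
have intE : oriented_integral (fun s => trg (g s a p) (tderiv g s a p)) t0 t =
    L a p t - L a p t0.
  apply: (oriented_integral_antiderivative hI_interval _ (dL a p dp) It0 It).
  move=> s Is; have := derivable_trg hI_open hg Is dp.
  by move=> /derivableP; exact: is_derive_continuous.
split; last by rewrite intE.
(* The square root halves the exponent of the determinant, leaving exactly the inverse of the factor
   gained by H. *)
rewrite HE /mu detE mul1r; move: (\det _) (L a p t - _) => D x.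
rewrite [D * _]mulrC sqrtrM ?expR_ge0 //.
rewrite sqrt_expR mulNr -!mulrA; congr (_ * _).
by rewrite mulrA -expRD addNr expR0 mul1r.
Qed.
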